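(* Let $\{x^k\},\{\lambda^k\},\{w^k\},\{\rho_k\}$ be sequences generated by the augmented Lagrangian method (described in the context). Assume that (i) $F$ is bounded and pseudomonotone, (ii) the mappings $G:X\times X\to Y$ and $D_yG:X\times X\to L(X,Y)$ are completely continuous, and (iii) $x^{k+1}\in C$ and $\varepsilon^{k+1}-\mathcal{L}_{\rho_k}(x^{k+1},w^k)\in\mathcal{N}_C(x^{k+1})$ for all $k$, where $\{\varepsilon^k\}\subseteq X^*$ satisfies $\varepsilon^k\to0$. Assume moreover that $C$ is weakly compact. Then, for every $k\in\mathbb{N}$, the variational inequality subproblem $$x\in C,\qquad\langle\mathcal{L}_{\rho_k}(x,w^k),y-x\rangle\ge0\quad\forall y\in C$$ admits a solution.
   Context: Setting. $X,Y$ are real Banach spaces; $C\subseteq X$, $K\subseteq Y$ are nonempty closed convex sets; $F:X\to X^*$; $G:X\times X\to Y$ is Fréchet differentiable with respect to its second argument $y$, with derivative $D_yG(x,y)\in L(X,Y)$. $H$ is a real Hilbert space, $i:Y\hookrightarrow H$ is a continuous linear injection with dense range, and $\mathcal{K}\subseteq H$ is a closed convex set with $i^{-1}(\mathcal{K})=K$. Elements of $Y$ are identified with their images in $H$, and $\lambda\in H$ is identified with the element $y\mapsto(\lambda,i(y))_H$ of $Y^*$. $P_{\mathcal{K}}$ is the projection onto $\mathcal{K}$ in $H$. $\mathcal{N}_C(x)=\{\psi\in X^*:\langle\psi,s-x\rangle\le0\ \forall s\in C\}$ for $x\in C$. Augmented Lagrangian: for $x\in X$, $\lambda\in H$, $\rho>0$,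 $\mathcal{L}_\rho(x,\lambda):=F(x)+\rho D_yG(x,x)^*[G(x,x)+\lambda/\rho-P_{\mathcal{K}}(G(x,x)+\lambda/\rho)]\in X^*$. Also $V(x,\lambda,\rho):=\|G(x,x)-P_{\mathcal{K}}(G(x,x)+\lambda/\rho)\|_H$. Augmented Lagrangian method. Given $(x^0,\lambda^0)\in X\times H$, $\rho_0>0$, $\gamma>1$, $\tau\in(0,1)$ and a bounded set $B\subseteq H$, for $k=0,1,2,\dots$: choose $w^k\in B$; compute $x^{k+1}$ as an inexact solution of the variational inequality $x\in C$, $\langle\mathcal{L}_{\rho_k}(x,w^k),y-x\rangle\ge0$ for all $y\in C$ (the inexactness is that of hypothesis (iii)); set $\lambda^{k+1}:=\rho_k[G(x^{k+1},x^{k+1})+w^k/\rho_k-P_{\mathcal{K}}(G(x^{k+1},x^{k+1})+w^k/\rho_k)]$; if $k=0$ or $V(x^{k+1},w^k,\rho_k)\le\tau V(x^k,w^{k-1},\rho_{k-1})$, set $\rho_{k+1}:=\rho_k$, otherwise $\rho_{k+1}:=\gamma\rho_k$. The method is assumed not to terminate, so infinite sequences are generated. Bounded operator: maps bounded sets to bounded sets. Pseudomonotone (Brezis): $T:X\to X^*$ such that, whenever $x^k\rightharpoonup x$ and $\limsup_k\langle T(x^k),x^k-x\rangle\le0$, then $\langle T(x),x-y\rangle\le\liminf_k\langle T(x^k),x^k-y\rangle$ for all $y\in X$. Completely continuous: maps weakly convergent sequences to norm convergent ones with the corresponding limit, i.e. $z^k\rightharpoonup z$ implies $T(z^k)\to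 T(z)$. *)

(* Defs.v *)
From HB Require Import structures.
From mathcomp Require Import all_boot all_order all_algebra.
From mathcomp Require Import all_classical all_reals all_analysis.

Set Implicit Arguments.
Unset Strict Implicit.
Unset Printing Implicit Defensive.

Import Order.TTheory GRing.Theory Num.Theory.
Import numFieldNormedType.Exports.

Local Open Scope classical_set_scope.
Local Open Scope ring_scope.

(* contlin V W is the normed space L(V, W) of continuous linear maps, with the
   operator norm; dual V is the topological dual of V. *)

Section ContinuousLinear.
Context {R : realType} {V W : normedModType R}.

Definition contlin_pred : {pred V -> W} :=
  fun f => `[< linear f /\ continuous f >].

Lemma contlinP (f : V -> W) :
  reflect (linear f /\ continuous f) (f \in contlin_pred).
Proof. exact: asboolP. Qed.

Fact contlin_submod : submod_closed contlin_pred.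
Proof.
split.
  apply/contlinP; split=> [a u v|x]; last exact: cvg_cst.
  by rewrite /= scaler0 addr0.
move=> a f g /contlinP[lf cf] /contlinP[lg cg]; apply/contlinP; split.
  move=> b u v; rewrite !fctE lf lg !scalerDr !scalerA (mulrC a b).
  by rewrite -!addrA; congr (_ + _); rewrite addrCA.
move=> x; apply: cvgD; last exact: cg.
by apply: cvgZl_tmp; exact: cf.
Qed.

HB.instance Definition _ :=
  GRing.isSubmodClosed.Build R (V -> W) contlin_pred contlin_submod.

Record contlin := Contlin {
  contlin_fun :> V -> W;
  _ : contlin_fun \in contlin_pred
}.

HB.instance Definition _ := [isSub for contlin_fun].
HB.instance Definition _ := gen_eqMixin contlin.
HB.instance Definition _ := gen_choiceMixin contlin.
HB.instance Definition _ :=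
  [SubChoice_isSubLmodule of contlin by <:].

Definition opnorm (f : contlin) : R :=
  sup [set `|f x| | x in [set x : V | `|x| <= 1]].

Lemma contlin_linear (f : contlin) : linear f.
Proof. by case: f => f /= /contlinP[]. Qed.

Lemma contlin_continuous (f : contlin) : continuous f.
Proof. by case: f => f /= /contlinP[]. Qed.

HB.instance Definition _ (f : contlin) :=
  GRing.isLinear.Build R V W _ f (contlin_linear f).

Lemma contlinDE (f g : contlin) x : (f + g) x = f x + g x.
Proof. by []. Qed.

Lemma contlinZE a (f : contlin) x : (a *: f) x = a *: f x.
Proof. by []. Qed.

Lemma opnorm_has_sup (f : contlin) :
  has_sup [set `|f x| | x in [set x : V | `|x| <= 1]].
Proof.
split; first by exists `|f 0|, 0 => //=; rewrite normr0.
have /bounded_funP/(_ 1)[M fM] : bounded_near f (nbhs (0 : V)).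
  by apply: continuous_linear_bounded; exact: contlin_continuous.
by exists M => _ [x /= x1 <-]; exact: fM.
Qed.

Lemma le_opnorm_unit (f : contlin) x : `|x| <= 1 -> `|f x| <= opnorm f.
Proof.
move=> x1; apply: ub_le_sup; last by exists x.
by case: (opnorm_has_sup f).
Qed.

Lemma opnorm_le (f : contlin) M :
  (forall x, `|x| <= 1 -> `|f x| <= M) -> opnorm f <= M.
Proof.
move=> fM; apply: ge_sup; first by case: (opnorm_has_sup f).
by move=> _ [x /= x1 <-]; exact: fM.
Qed.

Lemma opnorm_ge0 (f : contlin) : 0 <= opnorm f.
Proof.
by apply: le_trans (@le_opnorm_unit f 0 _) => //; rewrite normr0.
Qed.

Lemma le_opnorm (f : contlin) x : `|f x| <= opnorm f * `|x|.
Proof.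
have [->|x0] := eqVneq x 0; first by rewrite linear0 !normr0 mulr0.
have nx0 : 0 < `|x| by rewrite normr_gt0.
rewrite -ler_pdivrMr// mulrC.
have -> : `|x|^-1 * `|f x| = `|f (`|x|^-1 *: x)|.
  by rewrite linearZ normrZ ger0_norm// invr_ge0.
apply: le_opnorm_unit.
by rewrite normrZ ger0_norm ?invr_ge0// mulVf ?normr_eq0.
Qed.

Fact opnormD (f g : contlin) : opnorm (f + g) <= opnorm f + opnorm g.
Proof.
apply: opnorm_le => x x1; rewrite contlinDE (le_trans (ler_normD _ _))//.
by rewrite lerD// le_opnorm_unit.
Qed.

Fact opnormZ a (f : contlin) : opnorm (a *: f) = `|a| * opnorm f.
Proof.
have le_Z b (g : contlin) : opnorm (b *: g) <= `|b| * opnorm g.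
  apply: opnorm_le => x x1.
  by rewrite contlinZE normrZ ler_wpM2l// le_opnorm_unit.
apply/eqP; rewrite eq_le le_Z/=.
have [->|a0] := eqVneq a 0; first by rewrite normr0 mul0r opnorm_ge0.
rewrite mulrC -ler_pdivlMr ?normr_gt0// mulrC -normfV.
by rewrite -{1}[f]scale1r -(mulVf a0) -scalerA le_Z.
Qed.

Fact opnorm0_eq0 (f : contlin) : opnorm f = 0 -> f = 0.
Proof.
move=> f0; apply/val_inj/funext => x /=; apply/eqP; rewrite -normr_le0.
by rewrite (le_trans (le_opnorm f x))// f0 mul0r.
Qed.

HB.instance Definition _ :=
  Lmodule_isNormed.Build R contlin opnormD opnormZ opnorm0_eq0.

End ContinuousLinear.

Arguments contlin {R} V W.
Arguments contlin_pred {R} V W.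

Notation dual V := (contlin V (_ ^o)).

(* f \o g as an element of L(U, W); for g : dual W this is the adjoint of f
   applied to g. *)

Section Composition.
Context {R : realType} {U V W : normedModType R}.

Fact contlin_comp_subproof (g : contlin V W) (f : contlin U V) :
  (g \o f : U -> W) \in contlin_pred U W.
Proof.
apply/contlinP; split=> [a u v|x]; first by rewrite /= !linearP.
by apply: continuous_comp; exact: contlin_continuous.
Qed.

Definition contlin_comp (g : contlin V W) (f : contlin U V) : contlin U W :=
  Contlin (contlin_comp_subproof g f).

End Composition.

Definition adjoint {R : realType} {V W : normedModType R}
  (T : contlin V W) (psi : dual W) : dual V := contlin_comp psi T.

(* Positive definiteness of the inner product is a consequence of inner_norm. *)
HB.mixin Record NormedModule_isInnerProduct (R : realType) H
    & NormedModule R H := {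
  inner : H -> H -> R ;
  innerC : forall u v : H, inner u v = inner v u ;
  innerP : forall (a : R) (u v w : H),
    inner (a *: u + v) w = a * inner u w + inner v w ;
  inner_norm : forall u : H, inner u u = `|u| ^+ 2
}.

#[short(type="hilbertType")]
HB.structure Definition Hilbert (R : realType) :=
  {H of CompleteNormedModule R H & NormedModule_isInnerProduct R H}.

Section HilbertSpace.
Context {R : realType} {H : hilbertType R}.
Implicit Types (u v h : H) (A : set H).

Lemma cauchy_schwarz u v : `|inner u v| <= `|u| * `|v|.
Proof.
have innerBl x y z : inner (x - y) z = inner x z - inner y z.
  by rewrite addrC -scaleN1r innerP mulN1r addrC.
have inner0 z : inner 0 z = 0 by rewrite -(subrr 0) innerBl subrr.
have innerZl t x z : inner (t *: x) z = t * inner x z.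
  by rewrite -[t *: x]addr0 innerP inner0 addr0.
have [->|v0] := eqVneq v 0; first by rewrite innerC inner0 !normr0 mulr0.
have nv0 : 0 < `|v| ^+ 2 by rewrite exprn_gt0// normr_gt0.
rewrite -(@ler_pXn2r _ 2) ?nnegrE ?mulr_ge0// exprMn real_normK ?num_real//.
set a : R := inner u v; pose t := a / `|v| ^+ 2.
have : 0 <= `|u - t *: v| ^+ 2 by rewrite exprn_ge0.
rewrite -inner_norm innerBl innerZl !(innerC _ (u - _)) !innerBl !innerZl.
rewrite !inner_norm (innerC v u) -/a /t divfK ?gt_eqF// subrr mulr0 subr0.
by rewrite subr_ge0 mulrAC ler_pdivrMr.
Qed.

Fact riesz_subproof h : (inner h : H -> R^o) \in contlin_pred H R^o.
Proof.
have lh : linear (inner h : H -> R^o).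
  by move=> a u v; rewrite innerC innerP !(innerC h).
apply/contlinP; split => //.
pose f : {linear H -> R^o} := HB.pack (inner h : H -> R^o)
  (GRing.isLinear.Build _ _ _ _ (inner h : H -> R^o) lh).
apply: (@bounded_linear_continuous _ _ _ f); apply/bounded_funP => r.
exists (`|h| * r) => x xr.
by rewrite (le_trans (cauchy_schwarz h x))// ler_wpM2l.
Qed.

Definition riesz h : dual H := Contlin (riesz_subproof h).

(* The metric projection onto A: the minimizer exists and is unique whenever A
   is nonempty, closed and convex; otherwise the value is irrelevant. *)
Definition proj A h : H :=
  get [set p | A p /\ forall q, A q -> `|h - p| <= `|h - q|].

End HilbertSpace.

Section WeakTopology.
Context {R : realType}.

(* V with the coarsest topology making every element of its dual continuous. *)
Definition weak (V : normedModType R) : Type :=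
  initial_topology (fun (x : V) => (fun phi => phi x) : {ptws dual V -> R^o}).

HB.instance Definition _ (V : normedModType R) := Topological.on (weak V).

Definition wcvg {V : normedModType R} (u : V^nat) (x : V) : Prop :=
  u @ \oo --> (x : weak V).

Lemma wcvgP {V : normedModType R} (u : V^nat) (x : V) :
  wcvg u x <-> forall phi : dual V, phi (u n) @[n --> \oo] --> phi x.
Proof.
rewrite /wcvg; set ev : weak V -> {ptws dual V -> R^o} := fun x phi => phi x.
have -> : (u @ \oo --> (x : weak V)) <->
    ((ev \o u) @ \oo --> (ev x : {ptws dual V -> R^o})).
  split=> [ux|eux].
    apply: (@cvg_comp _ (weak V) _ u ev _ _ _ ux).
    exact: (@initial_continuous V _ ev x).
  move=> B; rewrite nbhsE => -[_ [[A Aop <-] Ax] AB].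
  apply: (filterS AB).
  by apply: eux; exact: open_nbhs_nbhs.
by split=> [/pointwise_cvgP|eux]; [|apply/pointwise_cvgP].
Qed.

Definition weakly_compact {V : normedModType R} (C : set V) : Prop :=
  compact (C : set (weak V)).

End WeakTopology.

Section Operators.
Context {R : realType} {V W : normedModType R}.

Definition bounded_operator (T : V -> W) : Prop :=
  forall A : set V, bounded_set A -> bounded_set (T @` A).

Definition completely_continuous (T : V -> W) : Prop :=
  forall (u : V^nat) (x : V), wcvg u x -> T \o u @ \oo --> T x.

(* In the sense of Brezis; limits superior and inferior are taken in \bar R. *)
Definition pseudomonotone (T : V -> dual V) : Prop :=
  forall (u : V^nat) (x : V), wcvg u x ->
    (limn_esup (fun k => (T (u k) (u k - x))%:E) <= 0)%E ->
  forall y : V,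
    ((T x (x - y))%:E <= limn_einf (fun k => (T (u k) (u k - y))%:E))%E.

(* Only meant for x in C. *)
Definition normal_cone (C : set V) (x : V) : set (dual V) :=
  [set psi | forall s, C s -> psi (s - x) <= 0].

End Operators.

Section AugmentedLagrangian.
Context {R : realType} {X Y : normedModType R} {H : hilbertType R}.
Variables (F : X -> dual X) (G : X -> X -> Y) (DG : X -> X -> contlin X Y).
Variables (i : contlin Y H) (calK : set H).

(* The element h of H seen as the element y |-> (h, i y) of the dual of Y. *)
Definition dual_embed (h : H) : dual Y := adjoint i (riesz h).

Definition aug_residual (x : X) (lam : H) (rho : R) : H :=
  i (G x x) + rho^-1 *: lam - proj calK (i (G x x) + rho^-1 *: lam).

Definition aug_Lagrangian (rho : R) (x : X) (lam : H) : dual X :=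
  F x + rho *: adjoint (DG x x) (dual_embed (aug_residual x lam rho)).

Definition aug_feasibility (x : X) (lam : H) (rho : R) : R :=
  `|i (G x x) - proj calK (i (G x x) + rho^-1 *: lam)|.

(* x : iterates, lam : multipliers, w : safeguarded multipliers taken in B,
   rho : penalty parameters. The sense in which x k.+1 solves the k-th
   subproblem is left open here and has to be assumed separately. The values
   x 0 and lam 0 are unconstrained; for k = 0 the disjunction makes the index
   k.-1 irrelevant. *)
Record ALM_generated (gamma tau : R) (B : set H)
    (x : X^nat) (lam w : H^nat) (rho : R^nat) : Prop := {
  ALM_rho0 : 0 < rho 0%N ;
  ALM_gamma : 1 < gamma ;
  ALM_tau : 0 < tau < 1 ;
  ALM_bounded : bounded_set B ;
  ALM_safeguard : forall k, B (w k) ;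
  ALM_multiplier : forall k,
    lam k.+1 = rho k *: aug_residual (x k.+1) (w k) (rho k) ;
  ALM_penalty : forall k,
    rho k.+1 =
      if (k == 0%N) || (aug_feasibility (x k.+1) (w k) (rho k)
                        <= tau * aug_feasibility (x k) (w k.-1) (rho k.-1))
      then rho k else gamma * rho k
}.

End AugmentedLagrangian.

(* Main.v *)
Require Import Defs.
From HB Require Import structures.
From mathcomp Require Import all_boot all_order all_algebra.
From mathcomp Require Import all_classical all_reals all_analysis.
From mathcomp Require Import zify ring lra.

(** The k-th subproblem is the variational inequality on C for the operator
T = F + A, where A x = rho_k DG(x,x)^* r(x) and r(x) is the residual of the
projection onto calK.  The projection is nonexpansive, so complete continuity of
G and of DG makes A completely continuous
(penalty_completely_continuous).  Hence T is still pseudomonotone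
(pseudomonotoneD), and it is demicontinuous because a bounded pseudomonotone
operator is (pseudomonotone_demicontinuous).  The theorem is then the existence
theorem of Brezis for such operators on a weakly compact convex set
(weakly_compact_vi).

For that theorem let S(y) be the set of the z in C with T z (y - z) >= 0; a
solution is a common point of all the S(y).  Finitely many of them always meet,
already inside the polytope spanned by the points y: in barycentric coordinates
z the numbers f_i(z) = T z (y_i - z) satisfy sum_i z_i f_i(z) = 0, and a
continuous map with this property has a point where all the f_i are nonnegative
(simplex_complementarity), by Brouwer's theorem applied to the map that moves z
towards the y_i with f_i(z) < 0.  By weak compactness there is a z in the weak
closure of every finite intersection of sets S(y).  Given y in C, such a z lies
in the weak closure of the intersection of S(z) and S(y); if u_n is a sequence
in that intersection converging weakly to z, then T u_n (u_n - z) <= 0 and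
T u_n (u_n - y) <= 0, and pseudomonotonicity gives T z (z - y) <= 0.

Pseudomonotonicity speaks of sequences only, whereas a weak closure point is a
priori a limit of nets.  The passage from one to the other is the part of the
Eberlein-Smulian theorem proved by Whitley (weakly_compact_closure_seq): it
rests on Hahn-Banach functionals, which are obtained here from minimal sublinear
functionals.  Adding A to F needs moreover that weakly convergent sequences are
bounded (wcvg_bounded), which is Banach-Steinhaus on the dual space.

Brouwer's theorem is derived from a lemma of Scarf on a finite set carrying
several linear orders (exists_dominant_rainbow).  It plays the role of Sperner's
lemma, with the same parity proof, but needs no triangulation: the order by the
i-th coordinate on a grid of the simplex replaces the geometry. *)

Set Implicit Arguments.
Unset Strict Implicit.
Unset Printing Implicit Defensive.

Import Order.TTheory GRing.Theory Num.Theory.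
Import numFieldNormedType.Exports.

Local Open Scope classical_set_scope.
Local Open Scope ring_scope.

(** * A combinatorial lemma of Scarf *)
Section Scarf.
Local Open Scope set_scope.
Local Open Scope nat_scope.
Variables (V I : finType) (r : I -> V -> nat).
Hypothesis r_inj : forall i, injective (r i).
Implicit Types (A : {set V}) (i j : I) (v x : V).

(** No point lies above the least point of A for every order at once.  With #|I| points such a set plays the role of a full simplex of a
triangulation, called a room below, and with #|I| - 1 points that of a facet,
called a door. *)
Definition dominant A := [forall v, exists i, forall x in A, r i v <= r i x].

Lemma dominantP A :
  reflect (forall v, exists i, forall x, x \in A -> r i v <= r i x) (dominant A).
Proof.
apply: (iffP forallP) => Adom v.
  by have /existsP[i /forall_inP] := Adom v; exists i.
by apply/existsP; have [i] := Adom v; exists i; apply/forall_inP.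
Qed.

Lemma dominant_least A x : dominant A -> x \in A ->
  exists i, forall y, y \in A -> r i x <= r i y.
Proof. by move=> /dominantP/(_ x). Qed.

(** The points at which A fails to stay dominant when the order i is left out. *)
Definition above A i :=
  [set v | [forall (j | j != i), exists t in A, r j t < r j v]].

Lemma aboveP A i v :
  reflect (forall j, j != i -> exists2 t, t \in A & r j t < r j v)
    (v \in above A i).
Proof.
rewrite finset.inE; apply: (iffP forall_inP) => + j ji => /(_ _ ji).
  by move=> /exists_inP.
by move=> ?; apply/exists_inP.
Qed.

Definition extends A x := (x \notin A) && dominant (x |: A).

Lemma min_of A i : A != finset.set0 ->
  exists2 x, x \in A & forall y, y \in A -> r i x <= r i y.
Proof.
move=> /set0Pn[x0 x0A]; exists [arg min_(x < x0 in A) r i x].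
  by case: arg_minnP.
by case: arg_minnP => // x xA xmin y yA; exact: xmin.
Qed.

Lemma max_of A i : A != finset.set0 ->
  exists2 x, x \in A & forall y, y \in A -> r i y <= r i x.
Proof.
move=> /set0Pn[x0 x0A]; exists [arg max_(x > x0 in A) r i x].
  by case: arg_maxnP.
by case: arg_maxnP => // x xA xmin y yA; exact: xmin.
Qed.

Lemma min_map A : A != finset.set0 -> exists f : I -> V, forall i,
  f i \in A /\ forall y, y \in A -> r i (f i) <= r i y.
Proof.
move=> A0; have /choice[f fP] : forall i, exists x,
    x \in A /\ forall y, y \in A -> r i x <= r i y.
  by move=> i; have [x] := min_of i A0; exists x.
by exists f.
Qed.

(** Dominance at a point x of A itself says that x is the least element of A for
some order; this bounds the number of points of A by the number of orders. *)
Lemma min_map_onto A (f : I -> V) : dominant A ->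
  (forall i, f i \in A /\ forall y, y \in A -> r i (f i) <= r i y) ->
  f @: [set: I] = A.
Proof.
move=> Adom fP; apply/setP => x; apply/imsetP/idP => [[i _ ->]|xA].
  by case: (fP i).
have [i imin] := dominant_least Adom xA; exists i; first by rewrite finset.inE.
have [fA fmin] := fP i.
by apply/(r_inj (i := i))/eqP; rewrite eqn_leq imin// fmin.
Qed.

(** A door has one point less than there are orders, so exactly one coincidence
occurs among its minima; each of the two orders a and b involved can be left out
without losing a minimum.  They are the two sides of the door. *)
Lemma door_pair A : A != finset.set0 -> dominant A -> #|A|.+1 = #|I| ->
  exists f : I -> V, exists a b : I,
    [/\ a != b, f a = f b,
      forall i, f i \in A /\ forall y, y \in A -> r i (f i) <= r i y
    & forall x, x \in A -> (exists2 j, j != a & f j = x) /\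
                           (exists2 j, j != b & f j = x)].
Proof.
move=> A0 Adom Acard; have [f fP] := min_map A0.
have fonto := min_map_onto Adom fP.
have /injectivePn[a [b ab fab]] : ~~ injectiveb f.
  apply/negP => /injectiveP finj.
  by move: Acard; rewrite -fonto card_imset// cardsT; lia.
have onto c d : c != d -> f c = f d -> forall x, x \in A ->
    exists2 j, j != c & f j = x.
  move=> cd fcd x; rewrite -fonto => /imsetP[j _ ->].
  have [->|jc] := eqVneq j c; last by exists j.
  by exists d; rewrite // eq_sym.
exists f, a, b; split => //.
by move=> x xA; split; [apply: (onto a b)|apply: (onto b a)] => //; rewrite eq_sym.
Qed.

Definition top_above A i x :=
  x \in above A i /\ forall v, v \in above A i -> r i v <= r i x.

(** A room containing the door A arises by adding, on one of the two sides, the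
highest point above A.  The new point becomes the minimum of the room for that
order while all other minima are unchanged. *)
Lemma extendsE A (f : I -> V) a b : dominant A -> a != b -> f a = f b ->
  (forall i, f i \in A /\ forall y, y \in A -> r i (f i) <= r i y) ->
  (forall x, x \in A -> (exists2 j, j != a & f j = x) /\
                       (exists2 j, j != b & f j = x)) ->
  #|A|.+1 = #|I| ->
  forall x, extends A x <-> top_above A a x \/ top_above A b x.
Proof.
move=> Adom ab fab fP fonto Acard x; split => [/andP[xA xdom]|].
  have A'0 : x |: A != finset.set0.
    by apply/finset.set0Pn; exists x; rewrite setU11.
  have [g gP] := min_map A'0; have gonto := min_map_onto xdom gP.
  have ginj : injective g.
    have /imset_injP inj : #|g @: [set: I]| == #|[set: I]|.
      by rewrite gonto cardsU1 xA cardsT -Acard.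
    by move=> i j; apply: inj; rewrite finset.inE.
  have [i _ xi] : exists2 i, i \in [set: I] & x = g i.
    by apply/imsetP; rewrite gonto setU11.
  have gf j : j != i -> g j = f j.
    move=> ji; have [gA gmin] := gP j; have [fA fmin] := fP j.
    have {}gA : g j \in A.
      move: gA; rewrite finset.in_setU1 xi => /orP[/eqP/ginj ij|//].
      by rewrite ij eqxx in ji.
    apply/(r_inj (i := j))/eqP; rewrite eqn_leq fmin// andbT gmin//.
    by rewrite finset.in_setU1 fA orbT.
  have iab : (i == a) || (i == b).
    apply: contraT => /norP[ia ib]; move: ab; rewrite -(inj_eq ginj).
    by rewrite !gf 1?eq_sym// fab eqxx.
  have xtop : top_above A i x.
    have xabove j : j != i -> r j (f j) < r j x.
      move=> ji; rewrite ltn_neqAle -gf// (inj_eq (r_inj (i := j))).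
      have [_ ->] := gP j; last by rewrite setU11.
      by rewrite andbT xi (inj_eq ginj).
    split.
      by apply/aboveP => j ji; exists (f j); [case: (fP j)|exact: xabove].
    move=> v /aboveP vi; have [j jmin] := (dominantP _ xdom) v.
    have [<-|ji] := eqVneq j i; first by apply: jmin; rewrite setU11.
    have [t tA] := vi j ji; rewrite ltnNge jmin//.
    by rewrite finset.in_setU1 tA orbT.
  by case/orP: iab => /eqP <-; [left|right].
have ext i : (forall x, x \in A -> exists2 j, j != i & f j = x) ->
    top_above A i x -> extends A x.
  move=> onto [xi xmax]; apply/andP; split.
    apply/negP => /onto[j ji fjx]; move/aboveP: xi => /(_ j ji)[t tA].
    by rewrite ltnNge -fjx; case: (fP j) => _ ->.
  apply/dominantP => v; have [vi|vi] := boolP (v \in above A i).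
    exists i => y; rewrite finset.in_setU1 => /orP[/eqP->|yA]; first exact: xmax.
    have [j jmin] := (dominantP _ Adom) v.
    have [<-|ji] := eqVneq j i; first exact: jmin.
    by move/aboveP: vi => /(_ j ji)[t tA]; rewrite ltnNge jmin.
  have [j ji jA] : exists2 j, j != i & forall t, t \in A -> r j v <= r j t.
    move: vi; rewrite finset.inE => /forall_inPn[j ji /exists_inPn jA].
    by exists j => // t tA; rewrite leqNgt jA.
  exists j => y; rewrite finset.in_setU1 => /orP[/eqP->|]; last exact: jA.
  move/aboveP: xi => /(_ j ji)[t tA] /ltnW; apply: leq_trans; exact: jA.
by case; apply: ext => y /fonto[].
Qed.

Lemma top_above_exists A i v : v \in above A i -> exists x, top_above A i x.
Proof.
move=> vi; have [|x xi xmax] := @max_of (above A i) i; last by exists x.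
by apply/finset.set0Pn; exists v.
Qed.

Lemma top_above_uniq A i x y : top_above A i x -> top_above A i y -> x = y.
Proof.
move=> [xi xmax] [yi ymax]; apply: (r_inj (i := i)).
by apply/eqP; rewrite eqn_leq ymax// xmax.
Qed.

(** A point above A on both sides would be above A for every order. *)
Lemma top_above_neq A a b x : dominant A -> a != b ->
  top_above A a x -> ~ top_above A b x.
Proof.
move=> /dominantP/(_ x)[j jmin] ab [/aboveP xa _] [/aboveP xb _].
have [t tA] : exists2 t, t \in A & r j t < r j x.
  have [ja|/xa//] := eqVneq j a; apply: xb; rewrite ja; exact: ab.
by rewrite ltnNge jmin.
Qed.

(** The slack points close up the boundary: s i stands for the facet of the
simplex opposite to the vertex i, pushed to infinity. *)
Variables (s : I -> V) (c : V -> I).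
Hypothesis sK : cancel s c.
Hypothesis s_low : forall i v, r i (s i) <= r i v.
Hypothesis s_high : forall i j v, i != j -> (forall k, v != s k) ->
  r i v < r i (s j).

Let slacks j : {set V} := s @: [set~ j].

Let card_slacks j : #|slacks j|.+1 = #|I|.
Proof.
rewrite /slacks card_imset; last exact: can_inj sK.
by rewrite cardsC1; have : 0 < #|I| by [apply/card_gt0P; exists j]; lia.
Qed.

Let s_low_lt i v : v != s i -> r i (s i) < r i v.
Proof.
move=> vs; rewrite ltn_neqAle s_low andbT (inj_eq (r_inj (i := i))).
by rewrite eq_sym.
Qed.

(** A side of a door is closed only on the boundary, that is, when the door
consists of all the slack points but one. *)
Let slack_above A i : #|A|.+1 = #|I| -> (forall j, A != slacks j) ->
  s i \in above A i.
Proof.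
move=> Acard As; apply/aboveP => j ji; apply/exists_inP.
apply: contraT => /exists_inPn low; have /negP[] := As j.
rewrite eqEcard -ltnS card_slacks -Acard leqnn andbT.
apply/fintype.subsetP => t tA.
have := low t tA; rewrite -leqNgt => st.
have [k tk] : exists k, t = s k.
  apply/not_existsP => tns; move: st; rewrite leqNgt s_high// 1?eq_sym//.
  by move=> k; apply/eqP.
apply/imsetP; exists k => //; rewrite !finset.inE; apply/eqP => kj.
move: st; rewrite tk kj leqNgt s_low_lt//.
by rewrite (inj_eq (can_inj sK)) eq_sym.
Qed.

(** Inner doors have a room on each side; the outer door has a single room. *)
Let card_inner_door A : A != finset.set0 -> dominant A -> #|A|.+1 = #|I| ->
  (forall j, A != slacks j) -> #|[set x | extends A x]| = 2.
Proof.
move=> A0 Adom Acard As; have [f [a [b [ab fab fP fonto]]]] := door_pair A0 Adom Acard.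
have extE := extendsE Adom ab fab fP fonto Acard.
have [x xa] := top_above_exists (slack_above a Acard As).
have [y yb] := top_above_exists (slack_above b Acard As).
have -> : [set x | extends A x] = [set x; y].
  apply/setP => z; rewrite !finset.inE; apply/idP/orP => [/extE[za|zb]|[]/eqP->].
  - by left; rewrite (top_above_uniq za xa).
  - by right; rewrite (top_above_uniq zb yb).
  - by apply/extE; left.
  - by apply/extE; right.
rewrite cards2; case: eqVneq => // xy.
by case: (top_above_neq Adom ab xa); rewrite xy.
Qed.

Let dominant_slacks i0 : dominant (slacks i0).
Proof.
apply/dominantP => v; have [[m ->]|vs] := pselect (exists m, v = s m).
  by exists m => x _; exact: s_low.
exists i0 => _ /imsetP[k + ->]; rewrite !finset.inE => ki.
by rewrite ltnW// s_high 1?eq_sym// => m; apply/eqP => vm; apply: vs; exists m.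
Qed.

Let slack_above_slacks i0 : s i0 \in above (slacks i0) i0.
Proof.
apply/aboveP => j ji; exists (s j); last first.
  by rewrite s_low_lt// (inj_eq (can_inj sK)) eq_sym.
by apply: imset_f; rewrite !finset.inE.
Qed.

Let card_outer_door i0 : #|[set x | extends (slacks i0) x]| = 1.
Proof.
have [x xi0] := top_above_exists (slack_above_slacks i0).
suff extE : forall y, extends (slacks i0) y <-> top_above (slacks i0) i0 y.
  apply/eqP/cards1P; exists x; apply/setP => y; rewrite !finset.inE.
  apply/idP/eqP => [/extE/top_above_uniq|->]; last by apply/extE.
  by apply.
have [A0|A0] := eqVneq (slacks i0) finset.set0.
  have I1 j : j = i0.
    apply/eqP/negPn/negP => ji; move/setP/(_ (s j)): A0.
    by rewrite finset.inE => /negP[]; apply: imset_f; rewrite !finset.inE.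
  move=> y; rewrite A0 /extends finset.inE /= finset.setU0; split => [/dominantP ydom|[_ ymax]].
    split=> [|v _]; first by apply/aboveP => j; rewrite (I1 j) eqxx.
    by have [j] := ydom v; rewrite (I1 j); apply; rewrite finset.inE.
  apply/dominantP => v; exists i0 => z /finset.set1P ->; apply: ymax.
  by apply/aboveP => j; rewrite (I1 j) eqxx.
have Adom := dominant_slacks i0; have Acard := card_slacks i0.
have [f [a [b [ab fab fP fonto]]]] := door_pair A0 Adom Acard.
have extE := extendsE Adom ab fab fP fonto Acard.
have fs k : k != i0 -> f k = s k.
  move=> ki; have [_ fmin] := fP k; apply/(r_inj (i := k))/eqP.
  by rewrite eqn_leq s_low fmin// imset_f// !finset.inE.
have empty d : d != i0 -> f i0 = f d -> forall y, ~ top_above (slacks i0) d y.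
  move=> di fd y [/aboveP yd _].
  have [t tA ty] : exists2 t, t \in slacks i0 & r i0 t < r i0 y.
    by apply: yd; rewrite eq_sym.
  have [m ym] : exists m, y = s m.
    apply/not_existsP => ys; case/imsetP: tA ty => k; rewrite !finset.inE => ki ->.
    by rewrite ltnNge ltnW// s_high 1?eq_sym// => k'; apply/eqP.
  have [md|md] := eqVneq m d.
    by move: ty; rewrite ym md -fs// -fd ltnNge; have [_ ->] := fP i0.
  by have [t' _] := yd m md; rewrite ym ltnNge s_low.
have [ai|ai] := eqVneq a i0.
  move=> y; rewrite extE ai; split=> [[//|]|]; last by left.
  by move=> /empty[]; rewrite -?ai// eq_sym.
have [bi|bi] := eqVneq b i0.
  move=> y; rewrite extE bi; split=> [[|//]|]; last by right.
  by move=> /empty[]; rewrite -?bi.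
by move: ab; rewrite -(inj_eq (can_inj sK)) -!fs// fab eqxx.
Qed.

(** As in Sperner's lemma: if a room misses a colour but has a door showing all
the colours but i0, then exactly one colour is repeated in the room, and removing
either of its two holders gives such a door. *)
Let card_room_doors (A : {set V}) i0 : c @: A != [set: I] -> #|A| = #|I| ->
  odd #|[set x in A | c @: (A :\ x) == [set~ i0]]| = false.
Proof.
move=> cA Acard; set N := [set _ in A | _].
have [->|/finset.set0Pn[x]] := eqVneq N finset.set0; first by rewrite cards0.
rewrite finset.inE => /andP[xA /eqP cAx].
have injD z : z \in A -> c @: (A :\ z) = [set~ i0] -> {in A :\ z &, injective c}.
  move=> zA cAz; apply/imset_injP; rewrite cAz cardsC1 -Acard.
  by rewrite (cardsD1 z A) zA.
have : c x \in [set~ i0].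
  rewrite !finset.inE; apply: contra cA => /eqP cx.
  rewrite -(finset.setD1K xA) imsetU1 cAx cx finset.setUCr //.
rewrite -cAx => /imsetP[y yAx cxy].
have yA : y \in A by move: yAx; rewrite !finset.inE => /andP[].
have yx : y != x by move: yAx; rewrite !finset.inE => /andP[].
have cAy : c @: (A :\ y) = [set~ i0].
  rewrite -cAx; apply/setP => k; apply/imsetP/imsetP => -[z zA ->].
    have [->|zx] := eqVneq z x; first by exists y.
    by exists z => //; move: zA; rewrite !finset.inE zx => /andP[].
  have [->|zy] := eqVneq z y; first by exists x; rewrite // !finset.inE eq_sym yx.
  by exists z => //; move: zA; rewrite !finset.inE zy => /andP[].
have -> : N = [set x; y].
  apply/setP => z; rewrite !finset.inE; apply/andP/orP => [[zA /eqP cAz]|].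
    apply/orP; apply: contraT => /norP[zx zy]; case/eqP: yx.
    by apply: (injD z zA cAz); rewrite // !finset.inE eq_sym ?zx ?zy.
  by case=> /eqP ->; [rewrite xA cAx|rewrite yA cAy].
by rewrite cards2 eq_sym yx.
Qed.

(** Count in two ways the pairs of a room and one of its doors showing all the
colours but i0.  By doors the number is odd, since only the outer door is in an
odd number of rooms; by rooms it would be even if no room had all the colours. *)
Lemma dominant_rainbow : I -> exists A, dominant A /\ c @: A = [set: I].
Proof.
move=> i0; apply/not_existsP => noA.
pose D (B : {set V}) := (c @: B == [set~ i0]) && (#|B|.+1 == #|I|).
have sumE : \sum_(B | D B) #|[set x | extends B x]| =
            \sum_(A | dominant A && (#|A| == #|I|))
              #|[set x in A | c @: (A :\ x) == [set~ i0]]|.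
  under eq_bigr do rewrite -sum1_card.
  under [RHS]eq_bigr do rewrite -sum1_card.
  rewrite (exchange_big_dep predT)//= [RHS](exchange_big_dep predT)//=.
  apply: eq_bigr => x _.
  rewrite (reindex_onto (fun A => A :\ x) (fun B => x |: B)) /=; last first.
    by move=> B; rewrite finset.inE => /andP[_ /andP[xB _]]; rewrite finset.setU1K.
  apply: eq_bigl => A; rewrite !finset.inE /extends /D !finset.inE eqxx /=.
  have [xA|xA] := boolP (x \in A); last first.
    rewrite andbF /=; apply/andP => -[_ /eqP AE]; move: xA.
    by rewrite -AE setU11.
  rewrite finset.setD1K// eqxx andbT /=.
  rewrite (cardsD1 x A) xA add1n.
  by rewrite andbC -!andbA; congr (_ && _); rewrite andbC.
have evenR : odd (\sum_(A | dominant A && (#|A| == #|I|))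
              #|[set x in A | c @: (A :\ x) == [set~ i0]]|) = false.
  rewrite (big_morph odd oddD (erefl _)) big1// => A /andP[Adom /eqP Acard].
  by apply: card_room_doors => //; apply/eqP => cA; apply: (noA A).
have oddL : odd (\sum_(B | D B) #|[set x | extends B x]|).
  rewrite (bigD1 (slacks i0)) /=; last first.
    rewrite /D card_slacks eqxx andbT /slacks -imset_comp (eq_imset _ sK).
    by rewrite imset_id.
  rewrite oddD card_outer_door (big_morph odd oddD (erefl _)) big1//.
  move=> B /andP[/andP[/eqP cB /eqP Bcard] BA].
  have Bs j : B != slacks j.
    apply: contra BA => /eqP BE; move: cB; rewrite BE /slacks -imset_comp.
    rewrite (eq_imset _ sK) imset_id => /setP/(_ j); rewrite !finset.inE eqxx.
    by move=> /esym/negbT/negPn/eqP ->.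
  have [B0|B0] := eqVneq B finset.set0.
    have I1 j : j = i0.
      apply/eqP/negPn/negP => ji; move: cB; rewrite B0 imset0.
      by move=> /setP/(_ j); rewrite !finset.inE ji.
    case/eqP: (Bs i0); rewrite B0 /slacks; apply/setP => v; rewrite finset.inE.
    by apply/esym/imsetP => -[k]; rewrite !finset.inE (I1 k) eqxx.
  have [Bdom|Bdom] := boolP (dominant B); first by rewrite card_inner_door.
  rewrite (_ : [set x | extends B x] = finset.set0) ?cards0//.
  apply/setP => x; rewrite !finset.inE; apply: contraNF Bdom => /andP[_].
  move=> /dominantP xdom; apply/dominantP => v; have [i imin] := xdom v.
  by exists i => y yB; apply: imin; rewrite finset.in_setU1 yB orbT.
by rewrite sumE evenR in oddL.
Qed.

End Scarf.

(** The weights h need not be injective: ties are broken by an arbitrary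
enumeration, placed in the low digits of the rank r.  The set C collects the
colours whose slack point is not used by the rainbow room. *)
Lemma exists_dominant_rainbow (T I : finType) (h : I -> T -> nat) (c : T -> I) :
  T -> exists (A : {set T}) (C : {set I}),
    (forall i, i \in C -> exists2 t, t \in A & c t = i) /\
    (forall v, exists2 i, i \in C & forall t, t \in A -> (h i v <= h i t)%N).
Proof.
move=> t0.
pose M := (\max_(p : I * T) h p.1 p.2).+2.
have hM i t : ((h i t).+1 < M)%N.
  by rewrite /M !ltnS (leq_bigmax (F := fun p : I * T => h p.1 p.2) (i, t)).
pose w i (v : T + I) : nat :=
  match v with inl t => (h i t).+1 | inr j => if i == j then 0%N else M end.
pose N := #|{: T + I}|.
pose r i (v : T + I) : nat := (w i v * N + enum_rank v)%N.
have rkN (v : T + I) : (enum_rank v < N)%N by exact: ltn_ord.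
have r_lt i u v : (w i u < w i v)%N -> (r i u < r i v)%N.
  move=> uv; apply: (@leq_trans ((w i u).+1 * N)).
    by rewrite mulSn /r addnC ltn_add2r.
  by rewrite (leq_trans _ (leq_addr _ _))// leq_mul2r uv orbT.
have r_le i u v : (r i u <= r i v)%N -> (w i u <= w i v)%N.
  by move=> uv; rewrite leqNgt; apply/negP => /r_lt; rewrite ltnNge uv.
have r_inj i : injective (r i).
  move=> u v ruv; apply/enum_rank_inj/val_inj => /=.
  have wuv : w i u = w i v by apply/eqP; rewrite eqn_leq !r_le// ruv.
  by move: ruv; rewrite /r wuv => /addnI.
pose c' (v : T + I) : I := match v with inl t => c t | inr j => j end.
have s_low i v : (r i (inr i) <= r i v)%N.
  case: v => [t|j]; first by rewrite ltnW// r_lt//= eqxx.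
  have [->//|ij] := eqVneq j i.
  by rewrite ltnW// r_lt//= eqxx eq_sym (negPf ij).
have s_high i j v : i != j -> (forall k, v != inr k) -> (r i v < r i (inr j))%N.
  case: v => [t ij _|k _ /(_ k)]; last by rewrite eqxx.
  by rewrite r_lt//= (negPf ij).
have c'K : cancel inr c' by [].
have [A [/(dominantP r) Adom cA]] :=
  dominant_rainbow r_inj c'K s_low s_high (c t0).
have col i : exists2 v, v \in A & c' v = i.
  have : i \in c' @: A by rewrite cA finset.inE.
  by move=> /imsetP[v vA ->]; exists v.
exists [set t | inl t \in A]%SET, [set i | inr i \notin A]%SET; split.
  move=> i; rewrite finset.inE => iA; have [[t tA <-|j jA ji]] := col i.
    by exists t; rewrite // finset.inE.
  by move: ji jA iA => /= -> ->.
move=> t; have [i imin] := Adom (inl t); exists i.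
  rewrite finset.inE; apply/negP => /imin/r_le /=.
  by rewrite eqxx.
by move=> u; rewrite finset.inE => /imin/r_le.
Qed.

(** * Brouwer's theorem on the simplex *)
Section Grid.
Variable n : nat.
Local Open Scope nat_scope.
Implicit Types (N : nat) (i j : 'I_n.+1).

(** The discrete form of Brouwer's theorem, for a colouring c of the grid points
of the simplex of size N.  If A and C come from the combinatorial lemma and m i
is the least i-th coordinate on A for i in C, then the sum of the m i + 1 exceeds
N, as otherwise a grid point above all of them would contradict dominance.  Since
coordinates sum to N, every point of A then has coordinates within n + 1 of m i
for i in C and at most n + 1 for the other i. *)
Lemma grid_rainbow N (c : {ffun 'I_n.+1 -> 'I_N.+1} -> 'I_n.+1) :
  exists u : {ffun 'I_n.+1 -> 'I_N.+1}, \sum_i (u i : nat) = N /\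
    forall i, u i <= n.+1 \/
      exists2 t : {ffun 'I_n.+1 -> 'I_N.+1}, \sum_i (t i : nat) = N /\ c t = i &
        forall j, t j <= u j + n.+1 /\ u j <= t j + n.+1.
Proof.
pose grid := {t : {ffun 'I_n.+1 -> 'I_N.+1} | \sum_i (t i : nat) == N}.
have gridE (t : grid) : \sum_i (val t i : nat) = N by apply/eqP; exact: (valP t).
have coord (v : 'I_n.+1 -> nat) : \sum_i v i = N ->
    exists t : grid, forall i, val t i = v i :> nat.
  move=> vN; pose t := [ffun i => inord (v i) : 'I_N.+1].
  have tv i : t i = v i :> nat.
    by rewrite ffunE inordK// ltnS -vN (bigD1 i)//= leq_addr.
  have tN : \sum_i (t i : nat) == N by rewrite (eq_bigr _ (fun i _ => tv i)) vN.
  by exists (exist _ t tN).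
have [t0 _] : exists t : grid, forall i, val t i = (if i == ord0 then N else 0) :> nat.
  by apply: coord; rewrite -big_mkcond /= big_pred1_eq.
have [A [C [col dom]]] := @exists_dominant_rainbow grid 'I_n.+1
  (fun i t => val t i) (fun t => c (val t)) t0.
have [i0 i0C _] := dom t0; have [u uA _] := col i0 i0C.
have [m mP] : exists m : 'I_n.+1 -> nat, forall i,
    (forall t, t \in A -> m i <= val t i) /\ exists2 t, t \in A & m i = val t i.
  have /choice[f fP] i : exists k, (forall t, t \in A -> k <= val t i) /\
      exists2 t, t \in A & k = val t i.
    case: (arg_minnP (fun t : grid => val t i : nat) uA) => t tA tmin.
    by exists (val t i); split=> //; exists t.
  by exists f.
have mlt : N < \sum_(i in C) (m i).+1.
  rewrite ltnNge; apply/negP => mN.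
  (* the grid point that would lie above A; the remainder is put on i0 *)
  pose v i := (if i \in C then (m i).+1 else 0) +
              (if i == i0 then N - \sum_(i in C) (m i).+1 else 0).
  have [|t tv] := coord v.
    by rewrite big_split /= -!big_mkcond /= big_pred1_eq subnKC.
  have [i iC imin] := dom t; have [_ [s sA ms]] := mP i.
  have := imin s sA; rewrite tv /v iC ms addSn ltnNge => /negP; apply.
  by rewrite leq_addr.
have Cn : #|C| <= n.+1 by rewrite -[leqRHS]card_ord max_card.
have sumC t : t \in A -> forall i, i \in C ->
    val t i + \sum_(j in C) m j <= N + m i.
  move=> tA i iC.
  suff : val t i + \sum_(j in C) m j <= \sum_j (val t j : nat) + m i by rewrite gridE.
  rewrite (bigD1 i iC) /= addnCA addnC.
  rewrite [in leqRHS](bigD1 i)//= leq_add2r leq_add2l [leqRHS](bigID [in C]) /=.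
  rewrite (eq_bigl (fun j => (j != i) && (j \in C))); last by move=> j; rewrite andbC.
  by apply: leq_trans (leq_addr _ _); apply: leq_sum => j _; apply: (mP j).1.
have sumSC : \sum_(i in C) (m i).+1 = \sum_(i in C) m i + #|C|.
  by rewrite -sum1_card -big_split /=; apply: eq_bigr => i _; rewrite addn1.
have near t i : t \in A -> i \in C -> val t i <= m i + n.+1.
  by move=> /sumC/[apply]; move: mlt; rewrite sumSC; lia.
have far t i : t \in A -> i \notin C -> val t i <= n.+1.
  move=> tA iC; have : val t i + \sum_(j in C) m j <= \sum_j (val t j : nat).
    rewrite [leqRHS](bigD1 i)//= leq_add2l [leqRHS](bigID [in C]) /=.
    apply: leq_trans (leq_addr _ _).
    rewrite (eq_bigl (fun j => (j != i) && (j \in C))).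
      by apply: leq_sum => j _; apply: (mP j).1.
    by move=> j; case: eqVneq iC => // ->; case: (i \in C).
  by move: mlt; rewrite sumSC gridE; lia.
exists (val u); split; first exact: gridE.
move=> i; have [iC|iC] := boolP (i \in C); last by left; exact: far.
right; have [t tA cti] := col i iC; exists (val t); first by split=> //; exact: gridE.
suff half s1 s2 j : s1 \in A -> s2 \in A -> val s1 j <= val s2 j + n.+1.
  by move=> j; split; exact: half.
move=> s1A s2A; have [jC|jC] := boolP (j \in C).
  by rewrite (leq_trans (near _ _ s1A jC))// leq_add2r (mP j).1.
by rewrite (leq_trans (far _ _ s1A jC))// leq_addl.
Qed.

End Grid.

Section Brouwer.
Context {R : realType} {n : nat}.
Implicit Types (z : 'rV[R]_n.+1) (i : 'I_n.+1).

Definition simplex : set 'rV[R]_n.+1 :=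
  [set z | (forall i, 0 <= z ord0 i) /\ \sum_i z ord0 i = 1].

Lemma coord_cont i : continuous (fun z => z ord0 i).
Proof. exact: coord_continuous. Qed.

Lemma simplex_compact : compact simplex.
Proof.
have cube_compact : compact
    [set v : 'rV[R]_n.+1 | forall i, `[0 : R, 1]%classic (v ord0 i)].
  by apply: (rV_compact (A := fun=> `[0 : R, 1]%classic)) => i; exact: segment_compact.
apply: (subclosed_compact _ cube_compact).
- have -> : simplex = (\bigcap_i [set z : 'rV[R]_n.+1 | 0 <= z ord0 i]) `&`
      (fun z : 'rV[R]_n.+1 => \sum_i z ord0 i) @^-1` [set 1].
    by apply/seteqP; split=> z [z0 z1]; split=> // i; [move=> _|]; exact: z0.
  apply: closedI.
    apply: closed_bigI => i _.
    have /continuous_closedP/(_ [set y : R | 0 <= y]) := @coord_cont i.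
    by apply; exact: closed_ge.
  have /continuous_closedP/(_ [set 1 : R]) :
      continuous (fun z : 'rV[R]_n.+1 => \sum_i z ord0 i).
    apply: continuous_big => [|i _]; first exact: (@add_continuous R^o).
    exact: coord_cont.
  by apply; exact: closed_eq.
- move=> z [z0 z1] i /=; rewrite in_itv /= z0 /= -z1 (bigD1 i)//=.
  by rewrite lerDl sumr_ge0.
Qed.

(** A grid point t is coloured by a coordinate i with t_i <= g(t)_i, which exists
because both sides sum to 1.  At a cluster point z of nearly rainbow grid points,
either z_i = 0 or z is a limit of points of colour i, so z_i <= g(z)_i for all i;
equality follows by summing again. *)
Theorem brouwer_simplex (g : 'rV[R]_n.+1 -> 'rV[R]_n.+1) :
  {within simplex, continuous g} -> {homo g : z / simplex z} ->
  exists2 z, simplex z & g z = z.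
Proof.
move=> /subspace_continuousP gcont gsimplex.
pose pt N (t : {ffun 'I_n.+1 -> 'I_N.+2}) : 'rV[R]_n.+1 :=
  \row_i ((t i)%:R / N.+1%:R).
have pt_simplex N (t : {ffun 'I_n.+1 -> 'I_N.+2}) : (\sum_i (t i : nat))%N = N.+1 -> simplex (@pt N t).
  move=> tN; split=> [i|]; first by rewrite mxE divr_ge0.
  under eq_bigr do rewrite mxE.
  by rewrite -mulr_suml -natr_sum tN divff// pnatr_eq0.
have [c cP] : exists c : forall N, {ffun 'I_n.+1 -> 'I_N.+2} -> 'I_n.+1,
    forall N t, simplex (@pt N t) ->
      pt N t ord0 (c N t) <= g (pt N t) ord0 (c N t).
  have /choice[c cP] (Nt : {N & {ffun 'I_n.+1 -> 'I_N.+2}}) : exists i,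
      let z := pt (tag Nt) (tagged Nt) in
      simplex z -> z ord0 i <= g z ord0 i.
    apply/not_existsP => noi; set z := pt _ _ in noi.
    have zlt i : simplex z /\ g z ord0 i < z ord0 i.
      by have /not_implyP[zs /negP] := noi i; rewrite -ltNge.
    have zs := (zlt ord0).1; have [_ z1] := zs; have [_ gz1] := gsimplex z zs.
    suff : \sum_i g z ord0 i < \sum_i z ord0 i by rewrite z1 gz1 ltxx.
    rewrite (bigD1 ord0)//= [ltRHS](bigD1 ord0)//= ltr_leD ?(zlt _).2//.
    by apply: ler_sum => i _; exact/ltW/(zlt i).2.
  by exists (fun N t => c (existT _ N t)) => N t /(cP (existT _ N t)).
pose u N := sval (cid (grid_rainbow (c N))).
have uP N : (\sum_i (u N i : nat))%N = N.+1 /\ forall i, (u N i <= n.+1)%N \/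
    exists2 t : {ffun 'I_n.+1 -> 'I_N.+2}, (\sum_i (t i : nat))%N = N.+1 /\ c N t = i &
      forall j, (t j <= u N j + n.+1)%N /\ (u N j <= t j + n.+1)%N.
  exact: svalP (cid (grid_rainbow (c N))).
pose z_ N := pt N (u N).
have z_simplex N : simplex (z_ N) by apply: pt_simplex; case: (uP N).
have [z [zs zclu]] : simplex `&` cluster (z_ @ \oo) !=set0.
  by apply: simplex_compact; exists 0%N => // N _; exact: z_simplex.
exists z => //.
suff le_z i : z ord0 i <= g z ord0 i.
  have [_ z1] := zs; have [_ gz1] := gsimplex z zs.
  apply/rowP => i; apply/eqP; rewrite -subr_eq0.
  have : \sum_i (g z ord0 i - z ord0 i) == 0 by rewrite sumrB z1 gz1 subrr.
  rewrite psumr_eq0 => [/allP/(_ i)|j _]; last by rewrite subr_ge0.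
  by rewrite mem_index_enum => /(_ isT)/implyP/(_ isT).
rewrite leNgt; apply/negP => ltz.
have gz0 : 0 <= g z ord0 i by have [] := gsimplex z zs.
have : (g y - y) ord0 i @[y --> within simplex (nbhs z)] --> (g z - z) ord0 i.
  have lim : (g y - y) @[y --> within simplex (nbhs z)] --> g z - z.
    by apply: cvgB; [exact: gcont|exact: cvg_within].
  exact: (cvg_comp _ _ lim (@coord_cont i _)).
move=> /cvgr_lt /(_ 0); rewrite 2!mxE subr_lt0 => /(_ ltz).
rewrite near_withinE => /nbhs_ballP[d /= d0 zd].
have zi0 : 0 < z ord0 i := le_lt_trans gz0 ltz.
(* half of d for the grid points near z to stay in the ball where g y < y in
   coordinate i, half of z i for that coordinate not to be almost zero *)
pose e := Num.min d (z ord0 i) / 2.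
have e0 : 0 < e by rewrite divr_gt0// lt_min d0.
have en0 : 0 < e / n.+1%:R by rewrite divr_gt0.
have [M _ Me] := near_infty_natSinv_lt (PosNum en0).
have ze : nbhs z (ball z e) by exact: nbhsx_ballx.
have tail : (z_ @ \oo) (z_ @` [set N | (M <= N)%N]).
  by exists M => // N MN; exists N.
have [_ [[N /= MN <-] zNe]] := zclu _ _ tail ze.
have small : n.+1%:R / N.+1%:R < e.
  have := Me N MN; rewrite /= ltr_pdivlMr// mulrC; exact.
have [_ zj] := zNe.
have zNi j : `|z ord0 j - z_ N ord0 j| < e by exact: zj.
have e2d : e + e <= d by rewrite -splitr ge_min lexx.
have e2z : e + e <= z ord0 i by rewrite -splitr ge_min lexx orbT.
have [_ /(_ i)[ui|[t [tN ct] tu]]] := uP N.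
  have : z_ N ord0 i < e.
    rewrite mxE (le_lt_trans _ small)// ler_pM2r ?invr_gt0 ?ltr0n//.
    by rewrite ler_nat.
  by have := zNi i; rewrite ltr_norml; lra.
have := cP N t (pt_simplex N t tN); rewrite ct leNgt => /negP; apply.
suff zt : ball z d (pt N t).
  by have := zd _ zt (pt_simplex N t tN); rewrite /= 2!mxE subr_lt0.
split=> // i0 j; rewrite [i0]ord1 /ball /=.
have tz : `|z_ N ord0 j - pt N t ord0 j| < e.
  rewrite (le_lt_trans _ small)// !mxE -mulrBl normrM [`|_^-1|]ger0_norm//.
  rewrite ler_pM2r ?invr_gt0 ?ltr0n//; have [tu1 tu2] := tu j.
  by rewrite ler_distl lerBlDr -!natrD !ler_nat tu1 tu2.
rewrite (lt_le_trans _ e2d)// (le_lt_trans (ler_distD (z_ N ord0 j) _ _))//.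
by rewrite ltrD.
Qed.

End Brouwer.

Lemma rowmx_cvg {R : realType} {n : nat} {T : Type} (F : set_system T)
    (f : T -> 'rV[R]_n) (l : 'rV[R]_n) : Filter F ->
  (forall i, f x ord0 i @[x --> F] --> l ord0 i) -> f @ F --> l.
Proof.
move=> FF fl A [P lP PA]; apply: filterS PA _ => /=.
suff : \forall x \near F, forall i, P ord0 i (f x ord0 i).
  by apply: filterS => x Px i0 i; rewrite [i0]ord1.
by apply: filter_forall => i; apply: fl; exact: lP.
Qed.

(** The map g is the one of Nash: each coordinate is increased by (twice) the
negative part of f i and the result is normalised.  At a fixed point the negative
parts are proportional to z, so if they were not all 0 every f i with z_i > 0
would be negative, against the hypothesis on the sum. *)
Lemma simplex_complementarity {R : realType} {n : nat}
    (f : 'I_n.+1 -> 'rV[R]_n.+1 -> R) :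
  (forall i, continuous (f i)) ->
  (forall z, simplex z -> \sum_i z ord0 i * f i z = 0) ->
  exists2 z, simplex z & forall i, 0 <= f i z.
Proof.
move=> fcont walras.
pose m i (z : 'rV[R]_n.+1) : R := `|f i z| - f i z.
pose S z := \sum_i m i z.
have m0 i z : 0 <= m i z by rewrite subr_ge0 ler_norm.
have S0 z : 0 <= S z by exact: sumr_ge0.
have S1 z : 1 + S z != 0 by rewrite gt_eqF// ltr_pwDl.
pose g (z : 'rV[R]_n.+1) : 'rV[R]_n.+1 := \row_i ((z ord0 i + m i z) / (1 + S z)).
have mcont i : continuous (m i).
  move=> z.
  have nf : `|f i y| @[y --> z] --> `|f i z|.
    exact: (continuous_comp (fcont i z) (@norm_continuous R R^o (f i z))).
  by apply: (cvgB nf); exact: fcont.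
have Scont : continuous S.
  apply: continuous_big => [|i _]; first exact: (@add_continuous R^o).
  exact: mcont.
have gcont : continuous g.
  move=> z; apply: (@rowmx_cvg _ _ _ (nbhs z) g (g z) (nbhs_filter z)) => i.
  rewrite mxE.
  have -> : (fun x => g x ord0 i) =
      (fun x : 'rV[R]_n.+1 => (x ord0 i + m i x) / (1 + S x)).
    by apply/funext => x; rewrite mxE.
  apply: cvgM; first by apply: cvgD; [exact: coord_cont|exact: mcont].
  apply: cvgV => //; apply: cvgD; [exact: cvg_cst|exact: Scont].
have gsimplex : {homo g : z / simplex z}.
  move=> z [z0 z1]; split=> [i|]; first by rewrite mxE divr_ge0// addr_ge0.
  under eq_bigr do rewrite mxE.
  by rewrite -mulr_suml big_split /= z1 divff //; exact: S1.
have [z zs gz] := brouwer_simplex (continuous_subspaceT gcont) gsimplex.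
exists z => //; have [z0 z1] := zs.
have mz i : m i z = z ord0 i * S z.
  have := congr1 (fun x : 'rV[R]_n.+1 => x ord0 i * (1 + S z)) gz.
  by rewrite mxE divfK// mulrDr mulr1 => /addrI.
suff Sz : S z = 0.
  move=> i; move: (mz i); rewrite Sz mulr0 => /eqP.
  by rewrite subr_eq0 => /eqP <-.
apply/eqP; rewrite eq_le S0 andbT leNgt; apply/negP => Sgt0.
have fneg i : 0 < z ord0 i -> f i z < 0.
  move=> zi; have : 0 < m i z by rewrite mz mulr_gt0.
  by rewrite subr_gt0 ltNge; apply: contraNlt => fz; rewrite ger0_norm.
have [i zi] : exists i, 0 < z ord0 i.
  apply/not_existsP => nz; move: z1; rewrite big1 => [/eqP|i _].
    by rewrite eq_sym oner_eq0.
  by apply/eqP; rewrite eq_le z0 andbT leNgt; apply/negP.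
have := walras z zs; apply/eqP; rewrite lt_eqF// (bigD1 i)//=.
rewrite -[ltRHS]addr0 ltr_leD ?pmulr_rlt0 ?fneg//.
apply: sumr_le0 => j _; have := z0 j; rewrite le_eqVlt => /orP[/eqP<-|zj].
  by rewrite mul0r.
by rewrite ltW// pmulr_rlt0// fneg.
Qed.

Lemma convex_sum {R : realType} {V : lmodType R} (C : set V) n
    (v : 'I_n.+1 -> V) (z : 'I_n.+1 -> R) : convex_set C ->
  (forall i, C (v i)) -> (forall i, 0 <= z i) -> \sum_i z i = 1 ->
  C (\sum_i z i *: v i).
Proof.
move=> Cconv; elim: n v z => [|n IH] v z Cv z0.
  by rewrite !big_ord1 => ->; rewrite scale1r.
rewrite [\sum_i z i]big_ord_recl [\sum_i z i *: v i]big_ord_recl.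
set t := z ord0; set s := \sum_i z _ => z1.
have s0 : 0 <= s by exact: sumr_ge0.
have [s_eq0|s_neq0] := eqVneq s 0.
  rewrite big1 ?addr0 => [|i _].
    by move: z1; rewrite s_eq0 addr0 => ->; rewrite scale1r.
  move/eqP: s_eq0; rewrite psumr_eq0// => /allP/(_ i).
  by rewrite mem_index_enum => /(_ isT)/implyP/(_ isT)/eqP ->; rewrite scale0r.
pose w := \sum_i (z (lift ord0 i) / s) *: v (lift ord0 i).
have Cw : C w.
  apply: IH => [i|i|]; [exact: Cv|by rewrite divr_ge0|].
  by rewrite -mulr_suml divff.
have t0 : 0 <= t by exact: z0.
have t1 : t <= 1 by rewrite -z1 lerDl.
have := Cconv _ _ (Itv01 t0 t1) (mem_set (Cv ord0)) (mem_set Cw).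
rewrite inE; suff -> : \sum_i z (lift ord0 i) *: v (lift ord0 i) = (1 - t) *: w by [].
have -> : 1 - t = s by rewrite -z1 addrC addKr.
rewrite scaler_sumr; apply: eq_bigr => i _.
by rewrite scalerA mulrC divfK.
Qed.

(** * The Hahn-Banach theorem *)
Section HahnBanach.
Context {R : realType} {V : lmodType R}.
Implicit Types (p q : V -> R) (x y : V) (t : R).

(** Homogeneity is required as an inequality only, which is easier to check on an
infimum; equality follows, see sublinearZ. *)
Definition sublinear p :=
  (forall x y, p (x + y) <= p x + p y) /\
  (forall t x, 0 <= t -> p (t *: x) <= t * p x).

Lemma sublinear0 p : sublinear p -> p 0 = 0.
Proof.
move=> [pD pZ]; apply/eqP; rewrite eq_le; apply/andP; split.
  by have := pZ 0 0 (lexx 0); rewrite scale0r mul0r.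
by have := pD 0 0; rewrite addr0; lra.
Qed.

Lemma sublinearZ p t x : sublinear p -> 0 <= t -> p (t *: x) = t * p x.
Proof.
move=> ps; rewrite le_eqVlt => /orP[/eqP <-|t0].
  by rewrite scale0r mul0r sublinear0.
have [pD pZ] := ps; apply/eqP; rewrite eq_le (pZ _ _ (ltW t0))/=.
have := pZ t^-1 (t *: x); rewrite scalerA mulVf ?gt_eqF// scale1r invr_ge0 (ltW t0).
by move=> /(_ isT); rewrite ler_pdivlMl.
Qed.

Lemma sublinear_lower p x : sublinear p -> - p (- x) <= p x.
Proof.
move=> ps; rewrite -subr_ge0 opprK -(sublinear0 ps) -(subrr x).
exact: ps.1.
Qed.

(** The largest sublinear minorant of p that agrees with p at x and is linear on
the line through x. *)
Definition slope p x y := inf [set p (y + t *: x) - t * p x | t in [set t | 0 <= t]].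

Lemma slope_le p x y t : sublinear p -> 0 <= t ->
  slope p x y <= p (y + t *: x) - t * p x.
Proof.
move=> ps t0; apply: ge_inf; last by exists t.
exists (- p (- y)) => _ [s /= s0 <-].
have := ps.1 (- y) (y + s *: x).
by rewrite addKr (sublinearZ _ ps)//; lra.
Qed.

Lemma le_slope p x y m : (forall t, 0 <= t -> m <= p (y + t *: x) - t * p x) ->
  m <= slope p x y.
Proof.
move=> mle; apply: lb_le_inf; last by move=> _ [t /= t0 <-]; exact: mle.
by exists (p (y + 0 *: x) - 0 * p x), 0 => /=.
Qed.

Lemma slope_sublinear p x : sublinear p -> sublinear (slope p x).
Proof.
move=> ps; split=> [y z|s y].
  rewrite -lerBlDr; apply: le_slope => t t0.
  rewrite lerBlDr -lerBlDl; apply: le_slope => s s0.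
  have := slope_le x (y + z) ps (addr_ge0 t0 s0).
  have := ps.1 (y + t *: x) (z + s *: x).
  by rewrite addrACA -scalerDl; lra.
rewrite le_eqVlt => /orP[/eqP <-|s0].
  rewrite scale0r mul0r.
  have := slope_le x 0 ps (lexx 0).
  by rewrite scale0r addr0 (sublinear0 ps) mul0r subr0.
rewrite -ler_pdivrMl//; apply: le_slope => t t0; rewrite ler_pdivrMl//.
have := slope_le x (s *: y) ps (mulr_ge0 (ltW s0) t0).
by rewrite -scalerA -scalerDr (sublinearZ _ ps (ltW s0)) -mulrA -mulrBr.
Qed.

Lemma slope_le_self p x y : sublinear p -> slope p x y <= p y.
Proof.
move=> ps; have := slope_le x y ps (lexx 0).
by rewrite scale0r addr0 mul0r subr0.
Qed.

(** Zorn's lemma applies because the infimum of a chain of sublinear functionals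
below p is sublinear, and finite since they all dominate - p (- x). *)
Lemma minimal_sublinear p : sublinear p -> exists q, [/\ sublinear q,
  forall x, q x <= p x &
  forall r, sublinear r -> (forall x, r x <= q x) -> r = q].
Proof.
move=> ps.
pose T := {q | sublinear q /\ forall x, q x <= p x}.
pose below (q r : T) := `[< forall x, sval r x <= sval q x >].
have [|||A Atot|[q [qs qp]] qmin] := @Zorn T below.
- by move=> q; apply/asboolP.
- move=> a b c /asboolP ab /asboolP bc; apply/asboolP => x.
  exact: le_trans (bc x) (ab x).
- move=> [a aP] [b bP] /asboolP /= ab /asboolP /= ba; apply/eq_exist/funext => x.
  by apply/eqP; rewrite eq_le ab ba.
- have [[a0 Aa0]|A0] := pselect (A !=set0); last first.
    by exists (exist _ p (conj ps (fun x => lexx _))) => a Aa; case: A0; exists a.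
  pose m x := inf [set sval a x | a in A].
  have mle a x : A a -> m x <= sval a x.
    move=> Aa; apply: ge_inf; last by exists a.
    exists (- p (- x)) => _ [[b [bs bp]] Ab <-] /=.
    by apply: le_trans (sublinear_lower _ bs); rewrite lerN2.
  have mge l x : (forall a, A a -> l <= sval a x) -> l <= m x.
    move=> la; apply: lb_le_inf; first by exists (sval a0 x), a0.
    by move=> _ [a Aa <-]; exact: la.
  have ms : sublinear m.
    split=> [x y|t x].
      rewrite -lerBlDr; apply: (mge) => a Aa; rewrite lerBlDr -lerBlDl.
      apply: (mge) => b Ab; rewrite lerBlDr.
      have [/asboolP ab|/asboolP ba] := Atot a b Aa Ab.
        rewrite (le_trans (mle b _ Ab))// (le_trans ((svalP b).1.1 _ _))//.
        by rewrite addrC lerD2l.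
      rewrite (le_trans (mle a _ Aa))// (le_trans ((svalP a).1.1 _ _))//.
      by rewrite addrC lerD2r.
    rewrite le_eqVlt => /orP[/eqP <-|t0].
      rewrite scale0r mul0r -(sublinear0 (svalP a0).1); exact: mle.
    rewrite -ler_pdivrMl//; apply: (mge) => a Aa; rewrite ler_pdivrMl//.
    by rewrite (le_trans (mle a _ Aa))// (svalP a).1.2// ltW.
  have mp x : m x <= p x := le_trans (mle a0 x Aa0) ((svalP a0).2 x).
  by exists (exist _ m (conj ms mp)) => a Aa; apply/asboolP => x; exact: mle.
exists q; split=> // r rs rq.
have rp x : r x <= p x := le_trans (rq x) (qp x).
suff /(congr1 sval) : exist _ r (conj rs rp) = exist _ q (conj qs qp) :> T by [].
by apply: qmin; apply/asboolP.
Qed.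

(** A minimal sublinear functional equals its slope in every direction, hence is
additive.  Taking it below slope p x0 forces the value p x0 at x0. *)
Theorem hahn_banach p x0 : sublinear p ->
  exists f : V -> R^o, [/\ linear f, forall x, f x <= p x & f x0 = p x0].
Proof.
move=> ps; have [f [fs fp fmin]] := minimal_sublinear (slope_sublinear x0 ps).
have fD x y : f (x + y) = f x + f y.
  apply/eqP; rewrite eq_le fs.1 /=.
  have slopef : slope f y = f.
    by apply: fmin => [|z]; [exact: slope_sublinear|exact: slope_le_self].
  have := slope_le y x fs ler01; rewrite slopef scale1r mul1r.
  by rewrite lerBrDr.
have fN x : f (- x) = - f x.
  by apply/eqP; rewrite -addr_eq0 addrC -fD subrr (sublinear0 fs).
have fZ t x : f (t *: x) = t * f x.
  have [t0|t0] := leP 0 t; first exact: sublinearZ.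
  rewrite -[t]opprK scaleNr fN (sublinearZ _ fs) ?mulNr//.
  by rewrite oppr_ge0 ltW.
exists f; split=> [t x y|x|]; first by rewrite fD fZ.
  exact: le_trans (fp x) (slope_le_self _ _ ps).
apply/eqP; rewrite eq_le (le_trans (fp x0) (slope_le_self _ _ ps))/=.
rewrite -lerN2 -fN (le_trans (fp _))//.
have := slope_le x0 (- x0) ps ler01.
by rewrite scale1r mul1r addNr (sublinear0 ps) add0r.
Qed.

End HahnBanach.

(** * Functionals and the weak topology *)
Section DualExtension.
Context {R : realType} {V : normedModType R}.
Implicit Types (x y : V) (phi : dual V).

Lemma hahn_banach_dual (p : V -> R) x0 : sublinear p -> (forall x, p x <= `|x|) ->
  exists phi : dual V, (forall x, phi x <= p x) /\ phi x0 = p x0.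
Proof.
move=> ps pnorm; have [f [flin fp fx0]] := hahn_banach x0 ps.
pose g : {linear V -> R^o} := HB.pack f (GRing.isLinear.Build _ _ _ _ f flin).
have gcont : continuous g.
  apply: bounded_linear_continuous; apply/bounded_funP => r.
  exists r => x xr; rewrite (le_trans _ xr)// ler_norml.
  rewrite (le_trans (fp x) (pnorm x)) andbT lerNl.
  have -> : - f x = f (- x) by rewrite -[LHS](linearN g).
  by rewrite (le_trans (fp _))// (le_trans (pnorm _))// normrN.
have fP : f \in contlin_pred V R^o by apply/contlinP; split.
by exists (Contlin fP); split.
Qed.

Lemma norming_functional x0 :
  exists phi : dual V, (forall x, phi x <= `|x|) /\ phi x0 = `|x0|.
Proof.
apply: hahn_banach_dual => //; split=> [x y|t x t0]; first exact: ler_normD.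
by rewrite normrZ ger0_norm.
Qed.

(** Hahn-Banach for the distance to D, a seminorm that vanishes on D and not at
x0. *)
Lemma subspace_separation (D : set V) x0 :
  D 0 -> (forall x y, D x -> D y -> D (x + y)) ->
  (forall (t : R) x, D x -> D (t *: x)) -> ~ closure D x0 ->
  exists phi : dual V, (forall x, D x -> phi x = 0) /\ phi x0 != 0.
Proof.
move=> D0 DD DZ x0D; pose p x := inf [set `|x - d| | d in D].
have ple x d : D d -> p x <= `|x - d|.
  move=> Dd; apply: ge_inf; last by exists d.
  by exists 0 => _ [e _ <-].
have pge m x : (forall d, D d -> m <= `|x - d|) -> m <= p x.
  move=> mle; apply: lb_le_inf; last by move=> _ [d Dd <-]; exact: mle.
  by exists `|x - 0|, 0.
have p0 x : 0 <= p x by apply: pge.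
have ps : sublinear p.
  split=> [x y|t x].
    rewrite -lerBlDr; apply: (pge) => d Dd; rewrite lerBlDr -lerBlDl.
    apply: (pge) => e De; rewrite lerBlDl.
    rewrite (le_trans (ple _ _ (DD _ _ Dd De)))// opprD addrACA.
    exact: ler_normD.
  rewrite le_eqVlt => /orP[/eqP <-|t0].
    by rewrite scale0r mul0r (le_trans (ple _ _ D0))// subrr normr0.
  rewrite -ler_pdivrMl//; apply: (pge) => d Dd; rewrite ler_pdivrMl//.
  rewrite (le_trans (ple _ _ (DZ t _ Dd)))// -scalerBr normrZ gtr0_norm//.
have [phi [phip phix0]] : exists phi : dual V,
    (forall x, phi x <= p x) /\ phi x0 = p x0.
  apply: hahn_banach_dual => // x.
  by rewrite -[x in leRHS]subr0; exact: ple.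
have pD x : D x -> p x = 0.
  move=> Dx; apply/eqP; rewrite eq_le p0 andbT (le_trans (ple _ _ Dx))//.
  by rewrite subrr normr0.
exists phi; split=> [x Dx|].
  apply/eqP; rewrite eq_le -{1}(pD x Dx) phip /= -oppr_le0 -linearN.
  rewrite (le_trans (phip _))// pD// -scaleN1r; exact: DZ.
rewrite phix0; apply/eqP => px0; apply: x0D => B /nbhs_ballP[e /= e0 eB].
have [d Dd dx0] : exists2 d, D d & `|x0 - d| < e.
  apply: contrapT => /forall2NP far; move: e0; rewrite ltNge -px0 => /negP; apply.
  apply: pge => d Dd; have [//|/negP] := far d.
  by rewrite -leNgt.
by exists d; split=> //; apply: eB; rewrite -ball_normE.
Qed.

End DualExtension.

Section WeakSequences.
Context {R : realType} {V : normedModType R}.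
Implicit Types (x y : V) (phi : dual V).

Lemma weak_eval_continuous phi : continuous (phi : weak V -> R^o).
Proof.
move=> x; have ev := @initial_continuous V {ptws dual V -> R^o}
  (fun (x : V) => (fun phi => phi x) : {ptws dual V -> R^o}).
apply: (@cvg_comp _ _ _ _ (fun f : {ptws dual V -> R^o} => f phi) _ _ _ (ev x)).
exact: (@proj_continuous _ (fun=> R^o) phi).
Qed.

Lemma weak_nbhs_eval x phi (e : R) : 0 < e ->
  nbhs (x : weak V) [set y : V | `|phi y - phi x| < e].
Proof.
move=> e0; have /cvgrPdistC_lt/(_ e e0) := @weak_eval_continuous phi x; exact.
Qed.

Lemma weak_cluster_eval (F : set_system V) x phi (l : R) : Filter F ->
  cluster (F : set_system (weak V)) x -> phi y @[y --> F] --> l -> phi x = l.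
Proof.
move=> FF xF phil; apply/eqP; rewrite -subr_eq0 -normr_le0 leNgt; apply/negP => d0.
pose e := `|phi x - l| / 2; have e0 : 0 < e by rewrite divr_gt0.
have Fl : F [set y | `|phi y - l| < e].
  by have /cvgrPdistC_lt/(_ e e0) := phil.
have [y [/= yl yx]] := xF _ _ Fl (weak_nbhs_eval x phi e0).
have := ler_distD (phi y) (phi x) l; rewrite leNgt => /negP; apply.
by rewrite [ltRHS]splitr ltrD// distrC.
Qed.

Lemma weak_closure_approx (A : set V) x (s : seq (dual V)) (e : R) :
  closure (A : set (weak V)) x -> 0 < e ->
  exists2 a, A a & forall phi, phi \in s -> `|phi a - phi x| < e.
Proof.
move=> Ax e0.
suff /Ax[a [Aa /= aP]] : nbhs (x : weak V)
    [set a : V | forall phi, phi \in s -> `|phi a - phi x| < e] by exists a.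
elim: s => [|phi s IH]; first by apply: filterS filterT => a _ phi.
apply: filterS2 (weak_nbhs_eval x phi e0) IH => a /= aphi as_ psi.
by rewrite in_cons => /predU1P[->|] //; exact: as_.
Qed.

End WeakSequences.

(** * Sequences in weakly compact sets *)
Section Angelic.
Context {R : realType} {V : normedModType R}.
Implicit Types (x y : V) (phi : dual V) (u : V^nat).

Let comb (c : seq R) u : V := \sum_(i < size c) c`_i *: u i.

Let span u : set V := [set comb c u | c in setT].

Let comb_nthE (c : seq R) u n : (size c <= n)%N ->
  comb c u = \sum_(i < n) c`_i *: u i.
Proof.
move=> cn; rewrite /comb (big_ord_widen n (fun i => c`_i *: u i) cn).
rewrite big_mkcond /=; apply: eq_bigr => i _.
by case: ltnP => // ci; rewrite nth_default// scale0r.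
Qed.

Let spanD u x y : span u x -> span u y -> span u (x + y).
Proof.
move=> [c _ <-] [d _ <-]; pose n := maxn (size c) (size d).
exists (mkseq (fun i => c`_i + d`_i) n) => //.
rewrite (@comb_nthE _ _ n) ?size_mkseq// (@comb_nthE c _ n) ?leq_maxl//.
rewrite (@comb_nthE d _ n) ?leq_maxr// -big_split /=; apply: eq_bigr => i _.
by rewrite nth_mkseq// scalerDl.
Qed.

Let spanZ u (t : R) x : span u x -> span u (t *: x).
Proof.
move=> [c _ <-]; exists [seq t * a | a <- c] => //.
rewrite /comb size_map scaler_sumr; apply: eq_bigr => i _.
by rewrite (nth_map 0)// scalerA.
Qed.

Let span0 u : span u 0.
Proof. by exists [::] => //; rewrite /comb big_ord0. Qed.

Let span_mem u n : span u (u n).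
Proof.
exists (rcons (nseq n 0) 1) => //.
rewrite /comb size_rcons size_nseq big_ord_recr /=.
rewrite nth_rcons size_nseq ltnn eqxx scale1r big1 ?add0r// => i _.
by rewrite nth_rcons size_nseq ltn_ord nth_nseq ltn_ord scale0r.
Qed.

Let ratcomb (q : seq rat) u : V := comb [seq ratr a | a <- q] u.

Let span_ratcomb u x (e : R) : span u x -> 0 < e ->
  exists q, `|x - ratcomb q u| < e.
Proof.
move=> [c _ <-] e0; pose n := size c.
pose M := 1 + \sum_(i < n) `|u i|.
have M0 : 0 < M by rewrite ltr_pwDl// sumr_ge0.
have eM : 0 < e / M by rewrite divr_gt0.
have /choice[r rP] i : exists r : rat, `|c`_i - ratr r| <= e / M.
  have : c`_i - e / M < c`_i + e / M by rewrite ltrD2l gtrN.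
  move=> /rat_in_itvoo[r]; rewrite in_itv /= => /andP[r1 r2]; exists r.
  by rewrite ler_distlC !ltW.
exists (mkseq r n).
rewrite /ratcomb (@comb_nthE c u n)//.
rewrite (@comb_nthE _ u n) ?size_map ?size_iota// -sumrB.
rewrite (le_lt_trans (ler_norm_sum _ _ _))//.
apply: (@le_lt_trans _ _ (\sum_(i < n) e / M * `|u i|)).
  apply: ler_sum => i _; rewrite -scalerBl normrZ ler_wpM2r//.
  by rewrite (nth_map 0) ?size_mkseq// nth_mkseq.
by rewrite -mulr_sumr mulrAC ltr_pdivrMr// ltr_pM2l// /M ltrDr.
Qed.

Variables (C A : set V) (x : V).
Hypotheses (C_compact : weakly_compact C) (AC : A `<=` C)
  (Ax : closure (A : set (weak V)) x).

(** Whitley's construction.  The points v 0 = x, v 1, v 2, ... are chosen one after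
the other, v n.+1 in A and close to x for the norming functionals of the first
rational combinations of v 0, ..., v n.  In the limit the norming functionals of
all rational combinations of the sequence are tested, and those separate the
points of its closed span. *)
Let nu (y : V) : dual V := sval (cid (norming_functional y)).

Let nu_le y z : nu y z <= `|z|.
Proof. by rewrite /nu; case: cid => f /= []. Qed.

Let nu_self y : nu y y = `|y|.
Proof. by rewrite /nu; case: cid => f /= []. Qed.

Let code n : seq rat := odflt [::] (unpickle n).

Let tests (s : seq V) : seq (dual V) :=
  [seq nu (ratcomb (code j) (nth 0 s)) | j <- iota 0 (size s)].

Let next_ex (s : seq V) : exists a, A a /\
  forall phi, phi \in tests s -> `|phi a - phi x| < (size s).+1%:R^-1.
Proof.
have [|a Aa aP] := @weak_closure_approx _ _ A x (tests s) (size s).+1%:R^-1 Ax.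
  by rewrite invr_gt0.
by exists a.
Qed.

Let next s : V := sval (cid (next_ex s)).
Let state n : seq V := iter n (fun s => rcons s (next s)) [:: x].
Let v n : V := nth 0 (state n) n.

Let size_state n : size (state n) = n.+1.
Proof. by elim: n => //= n IH; rewrite size_rcons IH. Qed.

Let nth_state n i : (i <= n)%N -> nth 0 (state n) i = v i.
Proof.
elim: n => [|n IH]; first by rewrite leqn0 => /eqP->.
rewrite leq_eqVlt => /predU1P[->//|]; rewrite ltnS => ni.
by rewrite /= nth_rcons size_state ltnS ni IH.
Qed.

Let vS n : v n.+1 = next (state n).
Proof. by rewrite /v /= nth_rcons size_state ltnn eqxx. Qed.

Let A_vS n : A (v n.+1).
Proof. by rewrite vS /next; case: cid => a /= []. Qed.

Let ratcomb_state q n : (size q <= n.+1)%N ->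
  ratcomb q (nth 0 (state n)) = ratcomb q v.
Proof.
move=> qn; rewrite /ratcomb /comb; apply: eq_bigr => i _; congr (_ *: _).
apply: nth_state; rewrite -ltnS (leq_trans _ qn)//.
by rewrite -(size_map (ratr (R := R)) q).
Qed.

Let nu_cvg q : nu (ratcomb q v) (v n.+1) @[n --> \oo] --> nu (ratcomb q v) x.
Proof.
apply/cvgrPdistC_lt => e e0.
have [M _ Me] := near_infty_natSinv_lt (PosNum e0).
exists (maxn M (maxn (pickle q) (size q))) => // n /=.
rewrite !geq_max => /andP[Mn /andP[pn sn]].
have : nu (ratcomb q v) \in tests (state n).
  apply/mapP; exists (pickle q); first by rewrite mem_iota size_state /= add0n ltnS.
  by rewrite /code pickleK /= ratcomb_state// leqW.
rewrite vS /next; case: cid => a /= [_ aP] /aP /lt_trans; apply.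
rewrite size_state; apply: lt_trans (Me n Mn) => /=.
by rewrite ltf_pV2 ?posrE ?ltr0n// ltr_nat.
Qed.

(** If psi did not converge along v, the subsequence where psi stays away from
psi x would have a weak cluster point y in C.  It lies in the closed span of v and
the norming functionals nu agree on y and x, so y = x, which is absurd. *)
Lemma weakly_compact_closure_seq : exists u : V^nat, (forall n, A (u n)) /\ wcvg u x.
Proof.
exists (fun n => v n.+1); split=> [n|]; first exact: A_vS.
apply/wcvgP => psi; apply/cvgrPdistC_lt => e e0.
pose bad := [set n | e <= `|psi (v n.+1) - psi x|].
apply: contrapT => notnear.
pose F : set_system V := (fun n => v n.+1) @ within bad \oo.
have FF : ProperFilter F.
  apply: fmap_proper_filter; apply: Build_ProperFilter_ex => B [N _ NB].
  have [n Nn ben] : exists2 n, (N <= n)%N & bad n.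
    apply: contrapT => /forall2NP nobad; apply: notnear; exists N => // n /= Nn.
    by have [//|/negP] := nobad n; rewrite -ltNge.
  by exists n; exact: NB.
have FC : F C by exists 0%N => // n _ _; apply: AC; exact: A_vS.
have [y [Cy Fy]] := C_compact FF FC.
have Feval phi (l : R) : (phi (v n.+1) @[n --> \oo] --> l) -> phi y = l.
  move=> phil; apply: (weak_cluster_eval (F := F) _ Fy).
  move=> B /phil; exact: (cvg_within (F := \oo)).
have yspan : closure (span v) y.
  apply: contrapT => yD.
  have [psi' [psi'0 /eqP]] := subspace_separation (@span0 v) (@spanD v) (@spanZ v) yD.
  apply; apply: Feval; rewrite (_ : (fun n => _) = cst 0); first exact: cvg_cst.
  by apply/funext => n; rewrite psi'0//; exact: span_mem.
have xspan : span v x := span_mem v 0.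
have yx : y = x.
  apply/eqP; rewrite -subr_eq0 -normr_le0 leNgt; apply/negP => d0.
  pose d := `|y - x| / 4; have {}d0 : 0 < d by rewrite divr_gt0.
  have [z [zspan yz]] := yspan _ (nbhsx_ballx y d d0).
  have zxspan : span v (z - x) by rewrite -scaleN1r; apply/spanD/spanZ.
  have [q qd] := span_ratcomb zxspan d0.
  set r := ratcomb q v in qd.
  have near : `|y - x - r| < d + d.
    have -> : y - x - r = (y - z) + (z - x - r) by rewrite addrA addrA subrK.
    by rewrite (le_lt_trans (ler_normD _ _))// ltrD//; move: yz; rewrite -ball_normE.
  have r0 : nu r (y - x) = 0.
    have ryx : nu r y = nu r x := Feval _ _ (@nu_cvg q).
    by rewrite linearB /= [X in X - _]ryx subrr.
  have : `|r| < d + d.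
    rewrite -nu_self -[nu r r]subr0 -r0 -linearB (le_lt_trans (nu_le _ _))//.
    by rewrite distrC.
  have := ler_normD (y - x - r) r; rewrite subrK.
  have -> : `|y - x| = d * 4 by rewrite divfK.
  lra.
have Fbad : F [set z | e <= `|psi z - psi x|] by exists 0%N.
have [z [/= ez ze]] := Fy _ _ Fbad (weak_nbhs_eval y psi e0).
by move: ze; rewrite yx ltNge ez.
Qed.

End Angelic.

(** * Weakly convergent sequences are bounded *)
Section DualComplete.
Context {R : realType} {V : normedModType R} {W : completeNormedModType R}.

Lemma contlin_near_le (f g : contlin V W) (e : R) x : `|g - f| < e ->
  `|g x - f x| <= e * `|x|.
Proof.
move=> fg; have -> : g x - f x = (g - f) x by [].
by rewrite (le_trans (le_opnorm _ _))// ler_wpM2r// ltW.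
Qed.

Lemma contlin_complete (F : set_system (contlin V W)) :
  ProperFilter F -> cauchy F -> cvg F.
Proof.
move=> FF /cauchyP Fc.
have Fball (e : R) : 0 < e -> exists f : contlin V W, \forall g \near F, `|g - f| < e.
  move=> e0; have [f Ff] := Fc e e0; exists f; apply: filterS Ff => g.
  by rewrite -ball_normE /= distrC.
have pt_cvg x : cvg ((fun f : contlin V W => f x) @ F).
  apply: cauchy_cvg; apply/cauchyP => e e0.
  have e'0 : 0 < e / (1 + `|x|) by rewrite divr_gt0// ltr_pwDl.
  have [f Ff] := Fball _ e'0; exists (f x); apply: filterS Ff => g fg.
  rewrite -ball_normE /= distrC (le_lt_trans (contlin_near_le x fg))//.
  by rewrite mulrAC ltr_pdivrMr ?ltr_pwDl// ltr_pM2l// ltrDr.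
pose l x := lim ((fun f : contlin V W => f x) @ F).
have lE x : f x @[f --> F] --> l x by exact: pt_cvg.
have l_near (f : contlin V W) (e : R) x : (\forall g \near F, `|g - f| < e) ->
    `|l x - f x| <= e * `|x|.
  move=> Ff; have : `|g x - f x| @[g --> F] --> `|l x - f x|.
    by apply: cvg_norm; apply: cvgB => //; exact: cvg_cst.
  move=> /cvgr_to_le; apply; apply: filterS Ff => g; exact: contlin_near_le.
have llin : linear l.
  move=> a x y; apply: cvg_lim; first exact: norm_hausdorff.
  rewrite (_ : (fun f : contlin V W => _) =
      (fun f : contlin V W => a *: f x + f y)).
    by apply: cvgD; [apply: cvgZl_tmp|].
  by apply/funext => f; rewrite linearP.
pose L0 : {linear V -> W} := HB.pack l (GRing.isLinear.Build _ _ _ _ l llin).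
have lcont : continuous L0.
  apply: bounded_linear_continuous; apply/bounded_funP => r.
  have [f Ff] := Fball 1 ltr01.
  exists ((1 + `|f|) * r) => x xr.
  have -> : L0 x = (l x - f x) + f x by rewrite subrK.
  rewrite (le_trans (ler_normD _ _))// mulrDl lerD//.
    rewrite (le_trans (l_near f 1 x Ff))// ler_wpM2l//.
  by rewrite (le_trans (le_opnorm f x))// ler_wpM2l// opnorm_ge0.
have lP : l \in contlin_pred V W by apply/contlinP; split.
apply/cvg_ex; exists (Contlin lP); apply/cvgrPdist_lt => e e0.
have [f Ff] := Fball (e / 2) (divr_gt0 e0 (ltr0n _ 2)).
apply: filterS (Ff) => g fg; rewrite [e]splitr.
apply: le_lt_trans (ler_distD f _ _) _; apply: ler_ltD; last by rewrite distrC.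
apply: opnorm_le => x x1; rewrite (le_trans (l_near f _ x Ff))//.
by rewrite ler_piMr// divr_ge0// ltW.
Qed.

HB.instance Definition _ := Uniform_isComplete.Build (contlin V W) contlin_complete.

End DualComplete.

(** The evaluations at the u n are pointwise bounded on the dual space, which is
complete, so Banach-Steinhaus bounds them uniformly on the unit ball; norming
functionals turn that into a bound of the u n. *)
Lemma wcvg_bounded {R : realType} {V : normedModType R} (u : V^nat) (x : V) :
  wcvg u x -> exists M : R, forall n, `|u n| <= M.
Proof.
move=> /wcvgP ux.
pose ev (n : nat) (phi : dual V) : R^o := phi (u n).
have [|phi|M MP] := @Banach_Steinhauss R (dual V) R^o (range ev) _ _ 1.
- move=> _ [n _ <-]; split; last by move=> a phi psi.
  move=> r; exists (r * `|u n|) => phi phir.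
  by rewrite (le_trans (le_opnorm phi (u n)))// ler_wpM2r.
- have [M [_ uM]] := cvg_seq_bounded (cvgP _ (ux phi)).
  by exists (M + 1) => _ [n _ <-]; apply: uM; rewrite ?ltrDl.
exists M => n; have [phi [phile <-]] := norming_functional (u n).
have phi1 : `|phi| <= 1.
  apply: opnorm_le => y y1; rewrite ler_norml.
  rewrite lerNl -linearN (le_trans (phile _)) ?normrN//=.
  exact: le_trans (phile _) y1.
exact: le_trans (ler_norm _) (MP _ (imageT ev n) phi phi1).
Qed.

(** * Pseudomonotone operators *)
Lemma limn_esup_leP {R : realType} (f : R^nat) (d : R) :
  (limn_esup (fun k => (f k)%:E) <= d%:E)%E <->
  forall e : R, 0 < e -> \forall k \near \oo, f k <= d + e.
Proof.
rewrite /limn_esup limf_esupE; split=> [fd e e0|fd].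
  have : (ereal_inf [set ereal_sup ((fun k => (f k)%:E) @` A) | A in \oo] <
          (d + e)%:E)%E by rewrite (le_lt_trans fd)// lte_fin ltrDl.
  move=> /ereal_inf_lt[_ [A Aoo <-] supA]; apply: filterS Aoo => k Ak.
  rewrite -lee_fin ltW// (le_lt_trans _ supA)//.
  by apply: ereal_sup_ubound; exists k.
apply/lee_addgt0Pr => e e0; rewrite -EFinD.
apply: (@le_trans _ _ (ereal_sup ((fun k => (f k)%:E) @` [set k | f k <= d + e]))).
  by apply: ereal_inf_lbound; exists [set k | f k <= d + e] => //; exact: fd.
by apply: ge_ereal_sup => _ [k /= fk <-]; rewrite lee_fin.
Qed.

Lemma limn_einf_geP {R : realType} (f : R^nat) (d : R) :
  (d%:E <= limn_einf (fun k => (f k)%:E))%E <->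
  forall e : R, 0 < e -> \forall k \near \oo, d - e <= f k.
Proof.
rewrite /limn_einf leeNr -EFinN.
have := limn_esup_leP (fun k => - f k) (- d).
rewrite (_ : (fun k => (- f k)%:E) = \- (fun k => (f k)%:E))%E//.
move=> ->; split=> fd e e0; apply: filterS (fd e e0) => k.
  by rewrite lerNl opprD opprK.
by rewrite lerNl opprD opprK.
Qed.

Section Pseudomonotone.
Context {R : realType} {V : normedModType R}.
Implicit Types (T : V -> dual V) (u : V^nat) (x y h : V).

(** Inequalities up to e between real numbers replace the extended real limits, so
that convergent perturbations can be absorbed by linear arithmetic. *)
Lemma pseudomonotoneP T : pseudomonotone T <->
  forall u x, wcvg u x ->
    (forall e : R, 0 < e -> \forall k \near \oo, T (u k) (u k - x) <= e) ->
  forall y (e : R), 0 < e ->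
    \forall k \near \oo, T x (x - y) - e <= T (u k) (u k - y).
Proof.
split=> [Tpm u x ux ule y|Tpm u x ux /limn_esup_leP ule y]; last first.
  apply/limn_einf_geP; apply: (Tpm u x ux) => e e0.
  by apply: filterS (ule e e0) => k; rewrite add0r.
apply/limn_einf_geP; apply: (Tpm u x ux); apply/limn_esup_leP => e e0.
by apply: filterS (ule e e0) => k; rewrite add0r.
Qed.

Lemma cvg_wcvg u x : u @ \oo --> x -> wcvg u x.
Proof.
move=> ux; apply/wcvgP => phi; apply: (cvg_comp _ _ ux).
exact: contlin_continuous.
Qed.

Lemma not_near_seq x (P : set V) : ~ (\forall y \near x, P y) ->
  exists u, (forall n, `|u n - x| < n.+1%:R^-1) /\ forall n, ~ P (u n).
Proof.
move=> xP; have /choice[u uP] n : exists y, `|y - x| < n.+1%:R^-1 /\ ~ P y.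
  apply/not_existsP => all; apply: xP; apply/nbhs_ballP; exists n.+1%:R^-1 => /=.
    by rewrite invr_gt0.
  move=> y; rewrite -ball_normE /= distrC => yx; apply: contrapT => Py.
  exact: (all y).
by exists u; split=> n; have [] := uP n.
Qed.

Lemma cvg_inv_nat u x : (forall n, `|u n - x| < n.+1%:R^-1) -> u @ \oo --> x.
Proof.
move=> ux; apply/cvgrPdistC_lt => e e0.
have [N _ Ne] := near_infty_natSinv_lt (PosNum e0).
by exists N => // n Nn; exact: lt_trans (ux n) (Ne n Nn).
Qed.

(** It is enough that T _ h is lower semicontinuous for every h, as - h gives the
other half.  If u converges to x in norm, then T (u n) (u n - x) tends to 0 by
boundedness, and pseudomonotonicity at x - h bounds T x h by the inferior limit of
T (u n) h. *)
Lemma pseudomonotone_demicontinuous T : bounded_operator T -> pseudomonotone T ->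
  forall h, continuous (fun x => T x h : R^o).
Proof.
move=> Tbd /pseudomonotoneP Tpm.
have lsc h x (e : R) : 0 < e -> \forall y \near x, T x h - e < T y h.
  move=> e0; apply: contrapT => /not_near_seq[u [ux uh]].
  have ucvg := cvg_inv_nat ux.
  have [M M0 uM] : exists2 M : R, 0 < M & forall n, `|T (u n)| <= M.
    have : bounded_set (ball x 1).
      exists (`|x| + 1); split; first by rewrite num_real.
      move=> r xr y; rewrite -ball_normE /= distrC => yx; rewrite ltW//.
      rewrite (le_lt_trans _ xr)// -[y](subrK x) addrC (le_trans (ler_normD _ _))//.
      by rewrite lerD2l ltW.
    move=> /Tbd/pinfty_ex_gt0[M M0 TM]; exists M => // n; apply: TM.
    exists (u n) => //; rewrite -ball_normE /= distrC (lt_le_trans (ux n))//.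
    by rewrite invf_le1// ler1n.
  have small (d : R) : 0 < d -> \forall k \near \oo, `|T (u k) (u k - x)| <= d.
    move=> d0; have /cvgrPdistC_le/(_ (d / M)) := ucvg.
    rewrite divr_gt0// => /(_ isT); apply: filterS => k kd.
    rewrite (le_trans (le_opnorm _ _))//.
    rewrite (le_trans (ler_pM _ _ (uM k) kd))// ?opnorm_ge0//.
    by rewrite mulrC divfK// gt_eqF.
  have e30 : 0 < e / 3 by rewrite divr_gt0.
  have := Tpm u x (cvg_wcvg ucvg) _ (x - h) (e / 3) e30.
  move=> [d d0|K1 _ HK1].
    by apply: filterS (small d d0) => k; exact: le_trans (ler_norm _).
  have [K2 _ HK2] := small _ e30.
  have := HK1 _ (leq_maxl K1 K2); have := HK2 _ (leq_maxr K1 K2).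
  set k := maxn _ _; have := uh k => /negP; rewrite -leNgt.
  have -> : u k - (x - h) = (u k - x) + h by rewrite opprB addrA addrAC.
  have -> : x - (x - h) = h by rewrite subKr.
  rewrite linearD /= ler_norml; lra.
move=> h x; apply/cvgrPdist_lt => e e0.
near=> y; rewrite ltr_norml ltrNl opprB; apply/andP; split.
  have : T x (- h) - e < T y (- h) by near: y; exact: lsc.
  rewrite !linearN; lra.
have : T x h - e < T y h by near: y; exact: lsc.
lra.
Unshelve. all: by end_near. Qed.

Lemma completely_continuous_continuous {W : normedModType R} (T : V -> W) :
  completely_continuous T -> continuous T.
Proof.
move=> Tcc x; apply/cvgrPdist_lt => e e0; apply: contrapT => /not_near_seq[u [ux ue]].
have /cvgrPdist_lt/(_ e e0)[N _ NT] := Tcc u x (cvg_wcvg (cvg_inv_nat ux)).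
by apply: (ue N); exact: (NT N (leqnn N)).
Qed.

(** The first factor converges in norm and the second weakly, hence remains
bounded. *)
Lemma completely_continuous_pairing (A : V -> dual V) u x y :
  completely_continuous A -> wcvg u x ->
  A (u k) (u k - y) @[k --> \oo] --> A x (x - y).
Proof.
move=> Acc ux; have Au := Acc u x ux; have [M uM] := wcvg_bounded ux.
have -> : (fun k => A (u k) (u k - y)) =
    (fun k => (A (u k) - A x) (u k - y) + A x (u k - y)).
  by apply/funext => k; rewrite -contlinDE subrK.
rewrite -[A x (x - y)]add0r; apply: cvgD; last first.
  under eq_cvg do rewrite linearB.
  rewrite linearB; apply: cvgB; last exact: cvg_cst.
  by have /wcvgP := ux; apply.
pose N := `|M| + `|y| + 1.
have N0 : 0 < N by rewrite ltr_wpDl// addr_ge0.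
apply/cvgr0Pnorm_le => e e0.
have /cvgrPdistC_le/(_ (e / N)) := Au; rewrite divr_gt0// => /(_ isT).
apply: filterS => k ke; rewrite (le_trans (le_opnorm _ _))//.
have ukN : `|u k - y| <= N.
  rewrite (le_trans (ler_normB _ _))// /N ler_wpDr// lerD2r.
  exact: le_trans (uM k) (ler_norm _).
rewrite (le_trans (ler_pM _ _ ke ukN))// ?opnorm_ge0//.
by rewrite divfK// gt_eqF.
Qed.

Lemma pseudomonotoneD T (A : V -> dual V) :
  pseudomonotone T -> completely_continuous A ->
  pseudomonotone (fun x => T x + A x).
Proof.
move=> /pseudomonotoneP Tpm Acc; apply/pseudomonotoneP => u x ux ule y e e0.
have Apair z := completely_continuous_pairing (y := z) Acc ux.
have e20 : 0 < e / 2 by rewrite divr_gt0.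
have := Tpm u x ux _ y (e / 2) e20.
have /cvgrPdist_le/(_ _ e20) := Apair y.
move=> near1 near2; near=> k.
have : T x (x - y) - e / 2 <= T (u k) (u k - y).
  near: k; apply: near2 => d d0; have d20 : 0 < d / 2 by rewrite divr_gt0.
  have /cvgrPdist_le/(_ _ d20) := Apair x.
  rewrite subrr linear0 => near3; near=> k.
  have : (T (u k) + A (u k)) (u k - x) <= d / 2 by near: k; exact: ule.
  have : `|0 - A (u k) (u k - x)| <= d / 2 by near: k.
  rewrite contlinDE ler_norml; lra.
have : `|A x (x - y) - A (u k) (u k - y)| <= e / 2 by near: k.
rewrite !contlinDE ler_norml; lra.
Unshelve. all: by end_near. Qed.

End Pseudomonotone.

(** * Existence for variational inequalities *)
Section VariationalInequality.
Context {R : realType} {V : normedModType R}.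
Implicit Types (T : V -> dual V) (C : set V).

(** The barycentric coordinates of the polytope turn the inequality into a
complementarity problem on the simplex: the mean of the f i with weights z is
T x (x - x) = 0. *)
Lemma polytope_vi T n (v : 'I_n.+1 -> V) :
  (forall h, continuous (fun x => T x h : R^o)) ->
  exists2 z : 'rV[R]_n.+1, simplex z &
    let x := \sum_j z ord0 j *: v j in forall i, 0 <= T x (v i - x).
Proof.
move=> Tcont; pose p (z : 'rV[R]_n.+1) := \sum_j z ord0 j *: v j.
pose f i (z : 'rV[R]_n.+1) : R :=
  T (p z) (v i) - \sum_j z ord0 j * T (p z) (v j).
have pcont : continuous p.
  apply: continuous_big => [|j _]; first exact: add_continuous.
  by move=> z; apply: (@cvgZr_tmp _ V _ (nbhs z)); exact: (@coord_cont R n j z).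
have Tpcont h : continuous (fun z => T (p z) h : R^o).
  move=> z; exact: (continuous_comp (pcont z) (Tcont h (p z))).
have sumcont : continuous (fun z : 'rV[R]_n.+1 =>
    \sum_j z ord0 j * T (p z) (v j) : R^o).
  apply: continuous_big => [|j _]; first exact: (@add_continuous R^o).
  by move=> z; exact: (cvgM (@coord_cont R n j z) (Tpcont (v j) z)).
have fcont i : continuous (f i).
  by move=> z; exact: (cvgB (Tpcont (v i) z) (sumcont z)).
have fE i z : f i z = T (p z) (v i - p z).
  rewrite linearB /=; congr (_ - _); rewrite {3}/p linear_sum.
  by apply: eq_bigr => j _; rewrite linearZ.
have [z [z0 z1]|z zs fz] := simplex_complementarity fcont.
  under eq_bigr do rewrite mulrBr.
  by rewrite sumrB -mulr_suml z1 mul1r subrr.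
by exists z => //= i; rewrite -fE.
Qed.

(** The sets A s of the points solving the inequality against the finite family s
generate a proper filter; z is one of its weak cluster points.  Testing z against
y uses the family made of z and y, where z provides the upper bound that
pseudomonotonicity asks for. *)
Theorem weakly_compact_vi T C : pseudomonotone T ->
  (forall h, continuous (fun x => T x h : R^o)) ->
  weakly_compact C -> convex_set C -> C !=set0 ->
  exists z, C z /\ forall y, C y -> 0 <= T z (y - z).
Proof.
move=> /pseudomonotoneP Tpm Tcont Ccpt Cconv [y0 Cy0].
pose A (s : seq V) := [set z | C z /\ forall y, y \in s -> 0 <= T z (y - z)].
pose good (s : seq V) := forall y, y \in s -> C y.
have A_ex s : good s -> A s !=set0.
  move=> Cs; pose v (i : 'I_(size s).+1) := nth 0 (y0 :: s) i.
  have Cv i : C (v i).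
    have : v i \in y0 :: s by apply: mem_nth.
    by rewrite in_cons => /predU1P[->//|/Cs].
  have [z [z0 z1] /= zP] := polytope_vi v Tcont.
  exists (\sum_j z ord0 j *: v j); split; first exact: convex_sum.
  move=> y ys; have ysi : (index y (y0 :: s) < (size s).+1)%N.
    by rewrite index_mem in_cons ys orbT.
  have := zP (Ordinal ysi).
  have -> // : v (Ordinal ysi) = y.
  by rewrite [LHS]nth_index// in_cons ys orbT.
pose F := filter_from good A.
have FF : ProperFilter F.
  apply: filter_from_proper; last exact: A_ex.
  apply: filter_from_filter; first by exists [::].
  move=> s t Cs Ct; exists (s ++ t) => [y|z [Cz zP]].
    by rewrite mem_cat => /orP[/Cs|/Ct].
  by split; split=> // y ys; apply: zP; rewrite mem_cat ys ?orbT.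
have FC : F C by exists [::] => // z [].
have [z [Cz Fz]] := Ccpt F FF FC.
exists z; split=> // y Cy.
have good_zy : good [:: z; y].
  by move=> y'; rewrite !inE => /orP[]/eqP->.
have zcl : closure (A [:: z; y] : set (weak V)) z.
  by move=> B zB; apply: (Fz) zB; exists [:: z; y].
have AC : A [:: z; y] `<=` C by move=> ? [].
have [u [uA uz]] := weakly_compact_closure_seq Ccpt AC zcl.
have le0 w k : w \in [:: z; y] -> T (u k) (u k - w) <= 0.
  by move=> /(uA k).2; rewrite -oppr_le0 -linearN opprB.
rewrite -oppr_le0 -linearN opprB; apply/ler_addgt0Pr => e e0.
have := Tpm u z uz _ y e e0.
move=> [d d0|N _ /(_ N (leqnn N)) /= le].
  by exists 0%N => // k _; apply: le_trans (ltW d0); apply: le0; exact: mem_head.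
rewrite -lerBlDr (le_trans le)// le0//.
by rewrite !inE eqxx orbT.
Qed.

End VariationalInequality.

(** * The projection onto a closed convex set *)
Section Projection.
Context {R : realType} {H : hilbertType R}.
Implicit Types (u v h p q : H) (A : set H).

Lemma innerDl u v h : inner (u + v) h = inner u h + inner v h.
Proof. by have := innerP 1 u v h; rewrite scale1r mul1r. Qed.

Lemma inner0l h : inner 0 h = 0.
Proof. by apply: (addrI (inner 0 h)); rewrite -innerDl !addr0. Qed.

Lemma innerZl (t : R) u h : inner (t *: u) h = t * inner u h.
Proof. by have := innerP t u 0 h; rewrite addr0 inner0l addr0. Qed.

Lemma innerNl u h : inner (- u) h = - inner u h.
Proof. by rewrite -scaleN1r innerZl mulN1r. Qed.

Lemma normD_sqr u v : `|u + v| ^+ 2 = `|u| ^+ 2 + 2 * inner u v + `|v| ^+ 2.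
Proof.
rewrite -!inner_norm innerDl ![inner _ (u + v)]innerC !innerDl (innerC v u); ring.
Qed.

Lemma parallelogram u v :
  `|u + v| ^+ 2 + `|u - v| ^+ 2 = 2 * `|u| ^+ 2 + 2 * `|v| ^+ 2.
Proof.
rewrite !normD_sqr normrN [inner u (- v)]innerC innerNl (innerC v u); ring.
Qed.

Lemma convex_segment A p q (t : R) : convex_set A -> A p -> A q ->
  0 <= t -> t <= 1 -> A (p + t *: (q - p)).
Proof.
move=> Aconv Ap Aq t0 t1.
have := Aconv _ _ (Itv01 t0 t1) (mem_set Aq) (mem_set Ap); rewrite inE.
suff -> : p + t *: (q - p) = t *: q + (1 - t) *: p by [].
by rewrite scalerBr scalerBl scale1r addrCA.
Qed.

(** By the parallelogram law, near minimisers of the distance are close to each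
other: their midpoint cannot be much closer to h than they are. *)
Lemma projection_exists A h : A !=set0 -> closed A -> convex_set A ->
  exists p, A p /\ forall q, A q -> `|h - p| <= `|h - q|.
Proof.
move=> [a0 Aa0] Acl Aconv.
pose D := inf [set `|h - q| ^+ 2 | q in A].
have Dle q : A q -> D <= `|h - q| ^+ 2.
  by move=> Aq; apply: ge_inf; [exists 0 => _ [? _ <-]; exact: sqr_ge0|exists q].
pose near_min (e : R) := [set q | A q /\ `|h - q| ^+ 2 <= D + e].
pose F := filter_from [set e : R | 0 < e] near_min.
have FF : ProperFilter F.
  apply: filter_from_proper => [|e /= e0].
    apply: filter_from_filter; first by exists 1 => /=.
    move=> e d /= e0 d0; exists (Num.min e d); first by rewrite /= lt_min e0.
    move=> q [Aq qle]; split; split=> //; apply: le_trans qle _.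
      by rewrite lerD2l ge_min lexx.
    by rewrite lerD2l ge_min lexx orbT.
  have [_ [q Aq <-] qD] : exists2 r, [set `|h - q| ^+ 2 | q in A] r & r < D + e.
    apply: inf_adherent => //; split; first by exists (`|h - a0| ^+ 2), a0.
    by exists 0 => _ [? _ <-]; exact: sqr_ge0.
  by exists q; split=> //; exact: ltW.
have close e p q : near_min e p -> near_min e q -> `|p - q| ^+ 2 <= 4 * e.
  move=> [Ap ple] [Aq qle].
  have := parallelogram (h - p) (h - q).
  have -> : (h - p) - (h - q) = q - p by rewrite opprB addrC addrA subrK.
  have -> : (h - p) + (h - q) = 2 *: (h - (p + 2^-1 *: (q - p))).
    have -> : q - p = (h - p) - (h - q) by rewrite opprB [RHS]addrC addrA subrK.
    rewrite opprD [h + (- p - _)]addrA; move: (h - p) (h - q) => a b.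
    rewrite scalerBr scalerA divff ?pnatr_eq0// scale1r scaler_nat mulr2n.
    by rewrite -addrA opprB [a + (b - a)]addrC subrK.
  rewrite normrZ exprMn (distrC q) [`|2|]ger0_norm//.
  have := Dle _ (convex_segment Aconv Ap Aq (t := 2^-1) _ _).
  rewrite invr_ge0 invf_le1 ?ler1n// => /(_ (ler0n _ 2) isT).
  lra.
have Fnear (e : R) : 0 < e -> F (near_min e) by move=> e0; exists e.
have Fc : cauchy F.
  apply: cauchy_exP => e e0.
  pose d := e ^+ 2 / 8; have d0 : 0 < d by rewrite divr_gt0// exprn_gt0.
  have [q qd] := filter_ex (Fnear d d0).
  exists q; apply: filterS (Fnear d d0) => p pd.
  rewrite -ball_normE /= -(ltr_pXn2r (n := 2)) ?nnegrE ?normr_ge0 ?(ltW e0)//.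
  have := close d q p qd pd; have : 0 < e ^+ 2 by rewrite exprn_gt0.
  rewrite /d; lra.
have Fp : F --> lim F by exact: cauchy_cvg.
set p := lim F in Fp.
have hF : `|h - q| ^+ 2 @[q --> F] --> `|h - p| ^+ 2.
  have nF : `|h - q| @[q --> F] --> `|h - p|.
    by apply: cvg_norm; apply: cvgB => //; exact: cvg_cst.
  by rewrite expr2; apply: (cvgM nF nF).
have pD : `|h - p| ^+ 2 <= D.
  apply/ler_addgt0Pr => e e0; apply: (cvgr_to_le hF).
  by apply: filterS (Fnear e e0) => q [].
exists p; split=> [|q Aq].
  apply: (@closed_cvg _ _ F FF id A Acl _ p Fp).
  by apply: filterS (Fnear 1 ltr01) => q [].
rewrite -(ler_pXn2r (n := 2)) ?nnegrE//; exact: le_trans pD (Dle q Aq).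
Qed.

Lemma proj_spec A h : A !=set0 -> closed A -> convex_set A ->
  A (Defs.proj A h) /\ forall q, A q -> `|h - Defs.proj A h| <= `|h - q|.
Proof.
move=> A0 Acl Aconv.
exact: (getPex (P := [set p | A p /\ forall q, A q -> `|h - p| <= `|h - q|])
               (@projection_exists A h A0 Acl Aconv)).
Qed.

(** First-order condition on the segment from the projection to q. *)
Lemma proj_obtuse A h q : A !=set0 -> closed A -> convex_set A -> A q ->
  inner (h - Defs.proj A h) (q - Defs.proj A h) <= 0.
Proof.
move=> A0 Acl Aconv Aq; have [Ap pmin] := @proj_spec A h A0 Acl Aconv.
set p := Defs.proj A h in Ap pmin *; set c := inner _ _.
pose N := `|q - p| ^+ 2.
have step (t : R) : 0 < t -> t <= 1 -> 2 * c <= t * N.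
  move=> t0 t1; have := pmin _ (convex_segment Aconv Ap Aq (ltW t0) t1).
  rewrite opprD addrA -(ler_pXn2r (n := 2)) ?nnegrE// [leRHS]normD_sqr.
  rewrite normrN normrZ exprMn [inner _ (- _)]innerC innerNl innerZl innerC -/c.
  by rewrite (gtr0_norm t0) -/N => hmin; rewrite -(ler_pM2l t0); lra.
rewrite leNgt; apply/negP => c0.
have N0 : 0 <= N by exact: sqr_ge0.
have c_le : 2 * c <= N by rewrite -[N]mul1r; apply: step.
have N_gt0 : 0 < N by rewrite (lt_le_trans _ c_le)// mulr_gt0.
have := step (c / N); rewrite divfK ?gt_eqF// divr_gt0// ler_pdivrMr// mul1r.
by move=> /(_ isT); lra.
Qed.

Lemma proj_nonexpansive A h h' : A !=set0 -> closed A -> convex_set A ->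
  `|Defs.proj A h - Defs.proj A h'| <= `|h - h'|.
Proof.
move=> A0 Acl Aconv; set p := Defs.proj A h; set p' := Defs.proj A h'.
have pA : A p by case: (@proj_spec A h A0 Acl Aconv).
have pA' : A p' by case: (@proj_spec A h' A0 Acl Aconv).
have o1 : inner (h - p) (p' - p) <= 0 by exact: proj_obtuse.
have o2 : inner (h' - p') (p - p') <= 0 by exact: proj_obtuse.
have cs := le_trans (ler_norm _) (cauchy_schwarz (h - h') (p - p')).
have key : `|p - p'| ^+ 2 <= inner (h - h') (p - p').
  have -> : h - h' = (h - p) - (h' - p') + (p - p').
    by rewrite [in RHS]opprB [RHS]addrAC !subrKA.
  rewrite 2!innerDl innerNl inner_norm lerDr addr_ge0//.
    by rewrite innerC -oppr_le0 -innerNl opprB innerC.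
  by rewrite oppr_ge0.
have [->|d0] := eqVneq `|p - p'| 0; first by [].
have {}d0 : 0 < `|p - p'| by rewrite lt0r d0 normr_ge0.
by rewrite -(ler_pM2r d0) -expr2 (le_trans key).
Qed.

Lemma proj_continuous A : A !=set0 -> closed A -> convex_set A ->
  continuous (Defs.proj A).
Proof.
move=> A0 Acl Aconv h; apply/cvgrPdist_le => e e0.
have /cvgrPdist_le/(_ e e0) := @cvg_id _ (nbhs h).
by apply: filterS => h'; exact: le_trans (@proj_nonexpansive _ _ _ A0 Acl Aconv).
Qed.

End Projection.

(** * The penalty term and the subproblems *)
Section Penalty.
Context {R : realType}.

Lemma contlin_comp_cvg {U V W : normedModType R}
    (g : (contlin V W)^nat) (f : (contlin U V)^nat) g0 f0 :
  g @ \oo --> g0 -> f @ \oo --> f0 ->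
  contlin_comp (g n) (f n) @[n --> \oo] --> contlin_comp g0 f0.
Proof.
move=> gg ff; apply/cvgrPdistC_le => e e0.
have lim : `|g n - g0| * `|f n| + `|g0| * `|f n - f0| @[n --> \oo] --> (0 : R).
  have g0n : `|g n - g0| @[n --> \oo] --> (0 : R).
    have := cvg_norm (cvgB gg (cvg_cst g0)); rewrite subrr normr0; apply.
  have f0n : `|f n - f0| @[n --> \oo] --> (0 : R).
    have := cvg_norm (cvgB ff (cvg_cst f0)); rewrite subrr normr0; apply.
  have := cvgD (cvgM g0n (cvg_norm ff)) (cvgM (cvg_cst `|g0|) f0n).
  by rewrite mul0r mulr0 addr0; apply.
have /cvgr_le/(_ e e0) := lim; apply: filterS => n ne.
apply: opnorm_le => x x1; rewrite (le_trans _ ne)//.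
have -> : (contlin_comp (g n) (f n) - contlin_comp g0 f0) x =
    (g n - g0) (f n x) + g0 ((f n - f0) x).
  rewrite [in g0 _](_ : (f n - f0) x = f n x - f0 x)// linearB addrA.
  by rewrite [(g n - g0) _](_ : _ = g n (f n x) - g0 (f n x))// subrK.
rewrite (le_trans (ler_normD _ _))// lerD// (le_trans (le_opnorm _ _))//.
  by rewrite ler_wpM2l ?opnorm_ge0// le_opnorm_unit.
by rewrite ler_wpM2l ?opnorm_ge0// le_opnorm_unit.
Qed.

Lemma riesz_continuous {H : hilbertType R} : continuous (@riesz R H).
Proof.
move=> h; apply/cvgrPdist_le => e e0.
have /cvgrPdist_le/(_ e e0) := @cvg_id _ (nbhs h).
apply: filterS => h' hh'; apply: opnorm_le => x x1.
have -> : (riesz h - riesz h') x = inner (h - h') x by rewrite innerDl innerNl.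
rewrite (le_trans (cauchy_schwarz _ _))// (le_trans _ hh')//.
by rewrite ler_piMr.
Qed.

Lemma wcvg_diag {V : normedModType R} (u : V^nat) (x : V) :
  wcvg u x -> wcvg (fun n => (u n, u n)) (x, x).
Proof.
move=> /wcvgP ux; apply/wcvgP => phi.
pose dg (z : V) : V * V := (z, z).
have dgP : dg \in contlin_pred V (V * V)%type.
  by apply/contlinP; split=> // z; apply: cvg_pair; exact: cvg_id.
exact: (ux (contlin_comp phi (Contlin dgP))).
Qed.

Lemma penalty_completely_continuous {X Y : normedModType R} {H : hilbertType R}
    (G : X -> X -> Y) (DG : X -> X -> contlin X Y) (i : contlin Y H)
    (calK : set H) (lam : H) (rho : R) :
  calK !=set0 -> closed calK -> convex_set calK ->
  completely_continuous (fun z : X * X => G z.1 z.2) ->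
  completely_continuous (fun z : X * X => DG z.1 z.2) ->
  completely_continuous (fun x => rho *: adjoint (DG x x)
    (dual_embed i (aug_residual G i calK x lam rho))).
Proof.
move=> K0 Kcl Kconv Gcc DGcc u x ux.
have Gu : G (u n) (u n) @[n --> \oo] --> G x x.
  exact: (Gcc _ _ (wcvg_diag ux)).
have DGu : DG (u n) (u n) @[n --> \oo] --> DG x x.
  exact: (DGcc _ _ (wcvg_diag ux)).
have shift : i (G (u n) (u n)) + rho^-1 *: lam @[n --> \oo] -->
    i (G x x) + rho^-1 *: lam.
  apply: cvgD; last exact: cvg_cst.
  apply: (cvg_comp _ _ Gu); exact: contlin_continuous.
have res : aug_residual G i calK (u n) lam rho @[n --> \oo] -->
    aug_residual G i calK x lam rho.
  apply: cvgB => //; apply: (cvg_comp _ _ shift).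
  exact: proj_continuous.
apply: cvgZl_tmp; apply: contlin_comp_cvg => //.
apply: contlin_comp_cvg; last exact: cvg_cst.
apply: (cvg_comp _ _ res); exact: riesz_continuous.
Qed.

End Penalty.

Theorem lemma7p2 (R : realType) (X Y : completeNormedModType R)
  (H : hilbertType R)
  (C : set X) (K : set Y) (calK : set H)
  (F : X -> dual X) (G : X -> X -> Y) (DG : X -> X -> contlin X Y)
  (i : contlin Y H)
  (C_neq0 : C !=set0) (C_closed : closed C) (C_convex : convex_set C)
  (K_neq0 : K !=set0) (K_closed : closed K) (K_convex : convex_set K)
  (calK_closed : closed calK) (calK_convex : convex_set calK)
  (i_inj : injective i) (i_dense : dense (range i))
  (i_preim : i @^-1` calK = K)
  (G_diff : forall x y : X, is_diff y (G x) (DG x y))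
  (gamma tau : R) (B : set H)
  (x : X^nat) (lam w : H^nat) (rho : R^nat) (eps : (dual X)^nat)
  (alm : ALM_generated G i calK gamma tau B x lam w rho)
  (F_bounded : bounded_operator F) (F_pseudomonotone : pseudomonotone F)
  (G_cc : completely_continuous (fun z : X * X => G z.1 z.2))
  (DG_cc : completely_continuous (fun z : X * X => DG z.1 z.2))
  (x_feasible : forall k, C (x k.+1))
  (x_subproblem : forall k, normal_cone C (x k.+1)
    (eps k.+1 - aug_Lagrangian F G DG i calK (rho k) (x k.+1) (w k)))
  (eps_cvg0 : eps @ \oo --> 0)
  (C_wcompact : weakly_compact C) :
  forall k : nat, exists z : X, C z /\
    forall y : X, C y ->
      0 <= aug_Lagrangian F G DG i calK (rho k) z (w k) (y - z).
Proof.
move=> k.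
pose A z := rho k *: adjoint (DG z z)
  (dual_embed i (aug_residual G i calK z (w k) (rho k))).
have K0' : calK !=set0.
  by case: K_neq0 => y; rewrite -i_preim => Ky; exists (i y).
have Acc : completely_continuous A by exact: penalty_completely_continuous.
have Fcont := pseudomonotone_demicontinuous F_bounded F_pseudomonotone.
have Acont := completely_continuous_continuous Acc.
have Acont_at h : continuous (fun z => A z h : R^o).
  move=> z; apply/cvgrPdist_lt => e e0.
  have d0 : 0 < e / (1 + `|h|) by rewrite divr_gt0// ltr_pwDl.
  have /cvgrPdist_lt/(_ _ d0) := Acont z.
  apply: filterS => y /contlin_near_le yz; rewrite (le_lt_trans (yz h))//.
  by rewrite mulrAC ltr_pdivrMr ?ltr_pwDl// ltr_pM2l// ltrDr.
have Tcont h : continuous (fun z => (F z + A z) h : R^o).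
  by move=> z; exact: (@cvgD R R^o _ _ _ _ _ _ _ (Fcont h z) (Acont_at h z)).
exact: (weakly_compact_vi (pseudomonotoneD F_pseudomonotone Acc) Tcont).
Qed.
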